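(* Any non-degenerate generalised complex structure $\mathcal J$ on a transitive Courant algebroid over $M$ is isomorphic (via Courant algebroid isomorphisms) to a generalised complex structure $\mathcal J_{\mathrm{can}}:E_{\mathrm{can}}\to E_{\mathrm{can}}$, where $$E_{\mathrm{can}}=\mathbb TM\oplus\mathcal G_{\mathrm{can}}$$ is an untwisted Courant algebroid with quadratic Lie algebra bundle $\mathcal G_{\mathrm{can}}$ and (flat) connection $\nabla^{\mathrm{can}}$, and $$\mathcal J_{\mathrm{can}}=\mathcal J_\omega\oplus A$$ is the direct sum of the generalised complex structure $\mathcal J_\omega$ on $\mathbb TM$ associated with a symplectic form $\omega$ on $M$ and a $\nabla^{\mathrm{can}}$-parallel skew-symmetric field $A\in\Gamma(\mathrm{End}\,\mathcal G_{\mathrm{can}})$ of integrable complex structures on $\mathcal G_{\mathrm{can}}$. Moreover, the symplectic structure $\omega$ is determined by the isomorphism type of $\mathcal J$, and its diffeomorphism type depends only on the equivalence class (under equivalences of Courant algebroids) of $\mathcal J$.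
   Context: All manifolds are smooth and connected. $\mathbb TM=TM\oplus T^*M$. A scalar product is a non-degenerate symmetric bilinear form. A quadratic Lie algebra bundle $(\mathcal G,[\cdot,\cdot]_{\mathcal G},\langle\cdot,\cdot\rangle_{\mathcal G})$ is a vector bundle whose fibres are smoothly varying Lie algebras with ad-invariant scalar product. Standard Courant algebroid: $E=\mathbb TM\oplus\mathcal G$, defined by a quadratic Lie algebra bundle $\mathcal G$ and data $(\nabla,R,H)$, where $\nabla$ is a connection on $\mathcal G$ preserving $[\cdot,\cdot]_{\mathcal G}$ and $\langle\cdot,\cdot\rangle_{\mathcal G}$, $R\in\Omega^2(M,\mathcal G)$, $H\in\Omega^3(M)$, with $R^\nabla(X,Y)r=[R(X,Y),r]_{\mathcal G}$, $d^\nabla R=0$, $dH=\langle R\wedge R\rangle_{\mathcal G}$ ($\langle R\wedge R\rangle_{\mathcal G}(X,Y,Z,V)=2\sum_{\mathrm{cycl}(X,Y,Z)}\langle R(X,Y),R(Z,V)\rangle_{\mathcal G}$). The anchor is the projection $\pi:E\to TM$, the scalar product is $\langle X+\xi+r,Y+\eta+\tilde r\rangle=\frac12(\eta(X)+\xi(Y))+\langle r,\tilde r\rangle_{\mathcal G}$, and the Dorfman bracket is $[X,Y]=\mathcal L_XY+i_Yi_XH+R(X,Y)$, $[X,r]=-2\langle i_XR,r\rangle_{\mathcal G}+\nabla_Xr$, $[r_1,r_2]=2\langle\nabla r_1,r_2\rangle_{\mathcal G}+[r_1,r_2]_{\mathcal G}$, $[X,\eta]=\mathcal L_X\eta$, $[\eta_1,\eta_2]=[r,\eta]=0$,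 together with $[u,v]+[v,u]=2d\langle u,v\rangle$. It is called untwisted if $R=0$ and $H=0$ (then $\nabla$ is flat). Every transitive Courant algebroid (anchor surjective) is isomorphic to a standard one. Unless otherwise stated Courant algebroids are of neutral signature. An isomorphism of Courant algebroids over $M$ is a vector bundle isomorphism covering $\mathrm{Id}_M$ and intertwining anchors, scalar products and Dorfman brackets; an equivalence is the same but covering an arbitrary diffeomorphism $\varphi$ of $M$ (intertwining the anchors via $d\varphi$, etc.). An isomorphism (equivalence) of generalised complex structures $\mathcal J$ on $E$, $\mathcal J'$ on $E'$ is an isomorphism (equivalence) $I:E\to E'$ of Courant algebroids with $I\circ\mathcal J=\mathcal J'\circ I$. A generalised almost complex structure on $E$ is a skew-symmetric $\mathcal J\in\Gamma(\mathrm{End}\,E)$ with $\mathcal J^2=-\mathrm{Id}$; it is integrable (a generalised complex structure) if sections of its $i$-eigenbundle in $E^{\mathbb C}$ are closed under the Dorfman bracket. On a standard Courant algebroid, $\mathcal J$ is non-degenerate if $\pi\circ\mathcal J|_{T^*M}:T^*M\to TM$ is bijective; on a general transitive Courant algebroid non-degeneracy is defined by identification with a standard one (independent of the choice). For a symplectic form $\omega$ on $M$, $\mathcal J_\omega(X+\xi)=-\omega^{-1}\xi+\omega X$, where $\omega:TM\to T^*M$, $X\mapsto i_X\omega$. A field of integrable complex structures on $\mathcal G$ is $A\in\Gamma(\mathrm{End}\,\mathcal G)$ with $A^2=-\mathrm{Id}$ such that for all $p\in M$ the $i$-eigenspace of $A_p$ in $\mathcal G_p^{\mathbb C}$ is closed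 under the Lie bracket. *)

(* Defs.v *)
From HB Require Import structures.
From mathcomp Require Import all_boot all_order all_algebra.
From mathcomp Require Import all_classical all_reals all_analysis.

Set Implicit Arguments.
Unset Strict Implicit.
Unset Printing Implicit Defensive.

Import Order.TTheory GRing.Theory Num.Theory numFieldNormedType.Exports.

Local Open Scope classical_set_scope.
Local Open Scope ring_scope.

(* Geometric objects are records of raw data,
   and their axioms are separate predicates ([is_...]).  Operations on
   sections, such as brackets and connections, are defined on all set-theoretic
   sections, and only their values on smooth ones are meaningful. *)

(* On an open set U, [Ck k U f] is the usual class C^k. *)
Fixpoint Ck (R : realType) (n k : nat) (U : set 'rV[R]_n)
    (f : 'rV[R]_n -> R) : Prop :=
  match k with
  | 0%N => forall x, U x -> {for x, continuous f}
  | k'.+1 => (forall x, U x -> differentiable f x) /\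
             (forall v : 'rV[R]_n, Ck k' U ('D_v f))
  end.

Definition smooth_rV (R : realType) (n : nat) (U : set 'rV[R]_n)
    (f : 'rV[R]_n -> R) : Prop := forall k, Ck k U f.

(* [cfun] is the chart map on the domain [cdom], and [cinv] inverts it there;
   the values of [cfun] off [cdom], and of [cinv] off the image, are junk. *)
Record chart (R : realType) (T : Type) (n : nat) := Chart {
  cdom : set T;
  cfun : T -> 'rV[R]_n;
  cinv : 'rV[R]_n -> T
}.

Definition is_chart (R : realType) (T : topologicalType) (n : nat)
    (c : chart R T n) : Prop :=
  [/\ open (cdom c),
      open (cfun c @` cdom c),
      forall p, cdom c p -> cinv c (cfun c p) = p,
      forall p, cdom c p -> {for p, continuous (cfun c)} &
      forall x, (cfun c @` cdom c) x -> {for x, continuous (cinv c)}].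

Definition compatible (R : realType) (T : Type) (n : nat)
    (c c' : chart R T n) : Prop :=
  forall i, smooth_rV (cfun c @` (cdom c `&` cdom c'))
                      (fun x => cfun c' (cinv c x) 0 i).

Record manifold (R : realType) := Manifold {
  mcarrier :> topologicalType;
  mdim : nat;
  atlas : set (chart R mcarrier mdim);
  atlas_chart : forall c, atlas c -> is_chart c;
  atlas_compatible : forall c c', atlas c -> atlas c' -> compatible c c';
  atlas_cover : forall p : mcarrier, exists c, atlas c /\ cdom c p;
  mhausdorff : hausdorff_space mcarrier;
  msecond_countable : @second_countable mcarrier;
  mconnected : connected [set: mcarrier]
}.

Section Manifold.
Context {R : realType} {M : manifold R}.
Notation n := (mdim M).

Definition smooth_on (U : set M) (f : M -> R) : Prop :=
  forall c, @atlas R M c ->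
    smooth_rV (cfun c @` (U `&` cdom c)) (fun x => f (cinv c x)).

Definition smooth_fun (f : M -> R) : Prop := smooth_on [set: M] f.

Definition chart_at (p : M) : chart R M n := sval (cid (atlas_cover p)).

Definition transition (c c' : chart R M n) (q : M) : 'M[R]_n :=
  jacobian (cfun c' \o cinv c) (cfun c q).

End Manifold.

Definition smooth_map (R : realType) (M N : manifold R) (phi : M -> N) : Prop :=
  continuous phi /\
  forall c c', @atlas R M c -> @atlas R N c' -> forall i,
    smooth_rV (cfun c @` (cdom c `&` phi @^-1` cdom c'))
              (fun x => cfun c' (phi (cinv c x)) 0 i).

Definition diffeomorphism (R : realType) (M N : manifold R) (phi : M -> N) :
    Prop :=
  exists psi : N -> M,
    [/\ cancel phi psi, cancel psi phi, smooth_map phi & smooth_map psi].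

(* A vector bundle is given by its fibres and a family of local frames (local
   trivialisations) with smooth transition functions, see [is_vbundle]. *)
Record frame (R : realType) (M : manifold R) (fib : M -> vectType R) (k : nat) :=
  Frame {
    fdom : set M;
    fbasis : forall p : M, k.-tuple (fib p)
  }.

Record vbundle (R : realType) (M : manifold R) := VBundle {
  fib :> M -> vectType R;
  vrank : nat;
  frames : set (frame fib vrank)
}.

Definition section (R : realType) (M : manifold R) (V : vbundle M) : Type :=
  forall p : M, V p.

Section Bundles.
Context {R : realType} {M : manifold R}.
Notation n := (mdim M).

Definition is_vbundle (V : vbundle M) : Prop :=
  [/\ forall p, exists e, frames (v := V) e /\ fdom e p,
      forall e, frames (v := V) e ->
        open (fdom e) /\
        forall p, fdom e p -> basis_of fullv (fbasis e p) &
      forall e e', frames (v := V) e -> frames (v := V) e' ->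
        forall i j, smooth_on (fdom e `&` fdom e')
          (fun p => coord (fbasis e' p) j (tnth (fbasis e p) i))].

Definition smooth_section (V : vbundle M) (s : section V) : Prop :=
  forall e, frames (v := V) e ->
    forall i, smooth_on (fdom e) (fun p => coord (fbasis e p) i (s p)).

(* The coordinates of a tangent vector at p in the chart c transform by the
   Jacobians of the transition maps, so T_pM is identified with R^n through the
   chosen chart [chart_at p].  The frame of a chart c of the atlas is
   (d/dx^1, ..., d/dx^n). *)
Definition chart_frame (c : chart R M n) :
    frame (fun _ : M => 'rV[R]_n : vectType R) n :=
  @Frame R M (fun _ => 'rV[R]_n) n (cdom c)
    (fun p => [tuple delta_mx 0 i *m transition c (chart_at p) p | i < n]).

Definition tangent : vbundle M :=
  @VBundle R M (fun _ => 'rV[R]_n) n (chart_frame @` @atlas R M).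

Definition dual_frame (V : vbundle M) (e : frame V (vrank V)) :
    frame (fun p => 'Hom(V p, R^o) : vectType R) (vrank V) :=
  @Frame R M (fun p => 'Hom(V p, R^o)) (vrank V) (fdom e)
    (fun p => [tuple linfun (coord (fbasis e p) i : V p -> R^o)
              | i < vrank V]).

Definition dual (V : vbundle M) : vbundle M :=
  @VBundle R M (fun p => 'Hom(V p, R^o)) (vrank V)
    (@dual_frame V @` frames (v := V)).

Definition sum_frame (V W : vbundle M)
    (e : frame V (vrank V)) (e' : frame W (vrank W)) :
    frame (fun p => (V p * W p)%type : vectType R) (vrank V + vrank W) :=
  @Frame R M (fun p => (V p * W p)%type) (vrank V + vrank W)
    (fdom e `&` fdom e')
    (fun p => [tuple of [tuple of map (fun x => (x, 0)) (fbasis e p)] ++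
                        [tuple of map (fun y => (0, y)) (fbasis e' p)]]).

Definition dsum (V W : vbundle M) : vbundle M :=
  @VBundle R M (fun p => (V p * W p)%type) (vrank V + vrank W)
    [set e | exists e1 e2, [/\ frames (v := V) e1, frames (v := W) e2 &
                               e = sum_frame e1 e2]].

Definition cotangent : vbundle M := dual tangent.

(* Here and below, smoothness of bundle maps and tensor fields is tested on
   global smooth sections. *)
Definition smooth_endo (V : vbundle M) (A : forall p, V p -> V p) : Prop :=
  (forall p, linear (A p)) /\
  (forall s : section V,
     smooth_section s -> smooth_section (fun p => A p (s p) : V p)).

Definition scalar_product (V : vbundle M) (b : forall p, V p -> V p -> R) :
    Prop :=
  [/\ forall p u, linear (b p u : V p -> R^o),
      forall p u v, b p u v = b p v u,
      forall p u, (forall v, b p u v = 0) -> u = 0 &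
      forall s t : section V, smooth_section s -> smooth_section t ->
        smooth_fun (fun p => b p (s p) (t p))].

Definition vfield : Type := section tangent.

Definition vder (p : M) (v : tangent p) (f : M -> R) : R :=
  'D_v (f \o cinv (chart_at p)) (cfun (chart_at p) p).

Definition components (c : chart R M n) (X : vfield) (x : 'rV[R]_n) :
    'rV[R]_n :=
  X (cinv c x) *m transition (chart_at (cinv c x)) c (cinv c x).

Definition lie (X Y : vfield) : vfield := fun p =>
  let c := chart_at p in
  'D_(X p) (components c Y) (cfun c p) - 'D_(Y p) (components c X) (cfun c p).

(* The extension of v in T_pM to a vector field near p with constant components
   in [chart_at p].  It is only used in expressions which depend on its germ at
   p, and whose value at p does not depend on the choice of the extension. *)
Definition extend (p : M) (v : tangent p) : vfield := fun q =>
  v *m transition (chart_at p) (chart_at q) q.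

Definition dfun (f : M -> R) : section cotangent := fun p =>
  linfun (fun v => vder v f : R^o).

(* (L_X eta)(V) = X (eta V) - eta [X, V] *)
Definition lie_form (X : vfield) (eta : section cotangent) :
    section cotangent := fun p =>
  linfun (fun v => vder (X p) (fun q => eta q (extend v q))
                   - eta p (lie X (extend v) p) : R^o).

Definition is_form2 (w : forall p, tangent p -> tangent p -> R) : Prop :=
  [/\ forall p u, linear (w p u : tangent p -> R^o),
      forall p v, linear (w p ^~ v : tangent p -> R^o),
      forall p u, w p u u = 0 &
      forall X Y : vfield, smooth_section X -> smooth_section Y ->
        smooth_fun (fun p => w p (X p) (Y p))].

Definition is_form2V (V : vbundle M)
    (w : forall p, tangent p -> tangent p -> V p) : Prop :=
  [/\ forall p u, linear (w p u),
      forall p v, linear (w p ^~ v),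
      forall p u, w p u u = 0 &
      forall X Y : vfield, smooth_section X -> smooth_section Y ->
        smooth_section (fun p => w p (X p) (Y p) : V p)].

Definition is_form3 (h : forall p, tangent p -> tangent p -> tangent p -> R) :
    Prop :=
  (forall p u v, [/\ linear (h p u v : tangent p -> R^o),
                    linear (fun x => h p u x v : R^o) &
                    linear (fun x => h p x u v : R^o)]) /\
  (forall p u v, h p u u v = 0 /\ h p u v v = 0) /\
  (forall X Y Z : vfield,
     smooth_section X -> smooth_section Y -> smooth_section Z ->
     smooth_fun (fun p => h p (X p) (Y p) (Z p))).

(* Exterior derivatives are given by the invariant (Koszul) formula, and are only
   meaningful on smooth vector fields. *)
Definition d2 (w : forall p, tangent p -> tangent p -> R) (X Y Z : vfield)
    (p : M) : R :=
  vder (X p) (fun q => w q (Y q) (Z q))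
  - vder (Y p) (fun q => w q (X q) (Z q))
  + vder (Z p) (fun q => w q (X q) (Y q))
  - w p (lie X Y p) (Z p) + w p (lie X Z p) (Y p) - w p (lie Y Z p) (X p).

Definition d3 (h : forall p, tangent p -> tangent p -> tangent p -> R)
    (X Y Z V : vfield) (p : M) : R :=
  vder (X p) (fun q => h q (Y q) (Z q) (V q))
  - vder (Y p) (fun q => h q (X q) (Z q) (V q))
  + vder (Z p) (fun q => h q (X q) (Y q) (V q))
  - vder (V p) (fun q => h q (X q) (Y q) (Z q))
  - h p (lie X Y p) (Z p) (V p) + h p (lie X Z p) (Y p) (V p)
  - h p (lie X V p) (Y p) (Z p) - h p (lie Y Z p) (X p) (V p)
  + h p (lie Y V p) (X p) (Z p) - h p (lie Z V p) (X p) (Y p).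

Definition symplectic (w : forall p, tangent p -> tangent p -> R) : Prop :=
  [/\ is_form2 w,
      forall p u, (forall v, w p u v = 0) -> u = 0 &
      forall X Y Z : vfield,
        smooth_section X -> smooth_section Y -> smooth_section Z ->
        forall p, d2 w X Y Z p = 0].

(* X |-> i_X w *)
Definition flat (w : forall p, tangent p -> tangent p -> R) (p : M) :
    'Hom(tangent p, cotangent p) :=
  linfun (fun u => linfun (fun v => w p u v : R^o) : cotangent p).

(* [D p v s] is the covariant derivative of the section s along v in T_pM. *)
Definition is_connection (V : vbundle M)
    (D : forall p, tangent p -> section V -> V p) : Prop :=
  [/\ forall p s, smooth_section s -> linear (fun v => D p v s),
      forall p v (s t : section V), smooth_section s -> smooth_section t ->
        D p v (fun q => s q + t q) = D p v s + D p v t,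
      forall p v f (s : section V), smooth_fun f -> smooth_section s ->
        D p v (fun q => f q *: s q) = vder v f *: s p + f p *: D p v s &
      forall (X : vfield) (s : section V),
        smooth_section X -> smooth_section s ->
        smooth_section (fun p => D p (X p) s : V p)].

Definition curvature (V : vbundle M)
    (D : forall p, tangent p -> section V -> V p)
    (X Y : vfield) (s : section V) : section V := fun p =>
  D p (X p) (fun q => D q (Y q) s) - D p (Y p) (fun q => D q (X q) s)
  - D p (lie X Y p) s.

Definition dnabla2 (V : vbundle M)
    (D : forall p, tangent p -> section V -> V p)
    (w : forall p, tangent p -> tangent p -> V p)
    (X Y Z : vfield) : section V := fun p =>
  D p (X p) (fun q => w q (Y q) (Z q))
  - D p (Y p) (fun q => w q (X q) (Z q))
  + D p (Z p) (fun q => w q (X q) (Y q))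
  - w p (lie X Y p) (Z p) + w p (lie X Z p) (Y p) - w p (lie Y Z p) (X p).

End Bundles.

Arguments tangent {R} M.
Arguments cotangent {R} M.
Arguments vfield {R} M.

Definition dmap (R : realType) (M N : manifold R) (phi : M -> N) (p : M)
    (v : tangent M p) : tangent N (phi p) :=
  v *m jacobian (cfun (chart_at (phi p)) \o phi \o cinv (chart_at p))
                (cfun (chart_at p) p).

Definition symplectomorphic (R : realType) (M : manifold R)
    (w w' : forall p, tangent M p -> tangent M p -> R) : Prop :=
  exists phi : M -> M, diffeomorphism phi /\
    forall p u v, w' (phi p) (dmap phi u) (dmap phi v) = w p u v.

(* A pair (u, v) in V * V stands for u + iv in V^C. *)
Definition in_i_eigenspace (R : realType) (V : lmodType R) (f : V -> V)
    (u v : V) : Prop := f u = - v /\ f v = u.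

Record courant (R : realType) (M : manifold R) := Courant {
  cbundle :> vbundle M;
  anchor : forall p, cbundle p -> tangent M p;
  csp : forall p, cbundle p -> cbundle p -> R;
  dorfman : section cbundle -> section cbundle -> section cbundle
}.

Record qlie (R : realType) (M : manifold R) := QLie {
  qbundle :> vbundle M;
  qbr : forall p, qbundle p -> qbundle p -> qbundle p;
  qsp : forall p, qbundle p -> qbundle p -> R
}.

Record std_data (R : realType) (M : manifold R) := StdData {
  sG : qlie M;
  snabla : forall p, tangent M p -> section sG -> sG p;
  sR : forall p, tangent M p -> tangent M p -> sG p;
  sH : forall p, tangent M p -> tangent M p -> tangent M p -> R
}.

Section Courant.
Context {R : realType} {M : manifold R}.

Definition is_courant (E : courant M) : Prop :=
  [/\ is_vbundle E,
      scalar_product (@csp _ _ E),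
      (forall p, linear (@anchor _ _ E p)) /\
      (forall s : section E, smooth_section s ->
         smooth_section (fun p => anchor (s p) : tangent M p)),
      (forall u v : section E, smooth_section u -> smooth_section v ->
         smooth_section (dorfman u v)) /\
      (forall (a : R) (u v w : section E),
         smooth_section u -> smooth_section v -> smooth_section w ->
         forall p,
         dorfman (fun q => a *: u q + v q) w p
           = a *: dorfman u w p + dorfman v w p /\
         dorfman w (fun q => a *: u q + v q) p
           = a *: dorfman w u p + dorfman w v p) &
      forall u v w : section E,
        smooth_section u -> smooth_section v -> smooth_section w ->
        forall p,
        [/\ dorfman u (dorfman v w) p
              = dorfman (dorfman u v) w p + dorfman v (dorfman u w) p,
            vder (anchor (u p)) (fun q => csp (v q) (w q))
              = csp (dorfman u v p) (w p) + csp (v p) (dorfman u w p) &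
            csp (dorfman u v p + dorfman v u p) (w p)
              = vder (anchor (w p)) (fun q => csp (u q) (v q))]].

Definition ca_transitive (E : courant M) : Prop :=
  forall p (v : tangent M p), exists u : E p, anchor u = v.

Definition ca_neutral (E : courant M) : Prop :=
  forall p, exists (m : nat) (e : (m + m).-tuple (E p)),
    basis_of fullv e /\
    forall i j, csp (tnth e i) (tnth e j)
      = if i == j then (if (i < m)%N then 1 else -1) else 0.

Definition is_qlie (G : qlie M) : Prop :=
  [/\ is_vbundle G,
      scalar_product (@qsp _ _ G),
      forall p (a b c : G p),
        [/\ qbr a a = 0,
            qbr a (qbr b c) + qbr b (qbr c a) + qbr c (qbr a b) = 0 &
            qsp (qbr a b) c + qsp b (qbr a c) = 0],
      forall p (a : G p), linear (qbr a) /\ linear (@qbr _ _ G p ^~ a) &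
      forall s t : section G, smooth_section s -> smooth_section t ->
        smooth_section (fun p => qbr (s p) (t p) : G p)].

Definition is_std_data (D : std_data M) : Prop :=
  let G := sG D in
  let nabla := @snabla _ _ D in
  [/\ is_qlie G, is_connection nabla, is_form2V (@sR _ _ D),
      is_form3 (@sH _ _ D) &
  [/\ forall p v (s t : section G), smooth_section s -> smooth_section t ->
        nabla p v (fun q => qbr (s q) (t q))
          = qbr (nabla p v s) (t p) + qbr (s p) (nabla p v t),
      forall p v (s t : section G), smooth_section s -> smooth_section t ->
        vder v (fun q => qsp (s q) (t q))
          = qsp (nabla p v s) (t p) + qsp (s p) (nabla p v t),
      forall (X Y : vfield M) (s : section G),
        smooth_section X -> smooth_section Y -> smooth_section s ->
        forall p, curvature nabla X Y s p = qbr (sR D (X p) (Y p)) (s p),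
      forall X Y Z : vfield M,
        smooth_section X -> smooth_section Y -> smooth_section Z ->
        forall p, dnabla2 nabla (@sR _ _ D) X Y Z p = 0 &
      forall X Y Z V : vfield M,
        smooth_section X -> smooth_section Y ->
        smooth_section Z -> smooth_section V ->
        forall p, d3 (@sH _ _ D) X Y Z V p =
          2 * (qsp (sR D (X p) (Y p)) (sR D (Z p) (V p))
             + qsp (sR D (Y p) (Z p)) (sR D (X p) (V p))
             + qsp (sR D (Z p) (X p)) (sR D (Y p) (V p)))]].

Definition std_bundle (G : vbundle M) : vbundle M :=
  dsum (dsum (tangent M) (cotangent M)) G.

(* The bilinear extension of the defining brackets, where the brackets with
   reversed arguments are obtained from [u, v] + [v, u] = 2 d<u, v>:
     [xi, Y] = - L_Y xi + d (xi Y),  [r, Y] = 2 <i_Y R, r> - nabla_Y r. *)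
Definition std_dorfman (D : std_data M) (u v : section (std_bundle (sG D))) :
    section (std_bundle (sG D)) := fun p =>
  let X : vfield M := fun q => (u q).1.1 in
  let xi : section (cotangent M) := fun q => (u q).1.2 in
  let r : section (sG D) := fun q => (u q).2 in
  let Y : vfield M := fun q => (v q).1.1 in
  let eta : section (cotangent M) := fun q => (v q).1.2 in
  let s : section (sG D) := fun q => (v q).2 in
  ((lie X Y p,
    lie_form X eta p - lie_form Y xi p + dfun (fun q => xi q (Y q)) p
    + linfun (fun z => sH D (X p) (Y p) z
                       - 2 * qsp (sR D (X p) z) (s p)
                       + 2 * qsp (sR D (Y p) z) (r p)
                       + 2 * qsp (snabla z r) (s p) : R^o)),
   snabla (X p) s - snabla (Y p) r + sR D (X p) (Y p) + qbr (r p) (s p)).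

Definition standard (D : std_data M) : courant M :=
  @Courant R M (std_bundle (sG D))
    (fun p u => u.1.1)
    (fun p u v => 2^-1 * (v.1.2 u.1.1 + u.1.2 v.1.1) + qsp u.2 v.2)
    (@std_dorfman D).

(* If these data satisfy [is_std_data], then nabla is flat: its curvature is
   [0, r] = 0. *)
Definition untwisted (G : qlie M)
    (nabla : forall p, tangent M p -> section G -> G p) : std_data M :=
  @StdData R M G nabla (fun p _ _ => 0) (fun p _ _ _ => 0).

(* An equivalence covering phi.  Since phi and the maps I p are bijective, every
   section s of E has exactly one push-forward s', characterised by
   s' (phi p) = I p (s p). *)
Definition is_equivalence (E E' : courant M) (phi : M -> M)
    (I : forall p, E p -> E' (phi p)) : Prop :=
  let pushes (s : section E) (s' : section E') :=
    forall p, s' (phi p) = I p (s p) in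
  [/\ diffeomorphism phi,
      (forall p, linear (I p) /\ bijective (I p)) /\
      (forall s s', pushes s s' -> (smooth_section s <-> smooth_section s')),
      forall p u, anchor (I p u) = dmap phi (anchor u),
      forall p u v, csp (I p u) (I p v) = csp u v &
      forall u u' v v', smooth_section u -> smooth_section v ->
        pushes u u' -> pushes v v' ->
        pushes (dorfman u v) (dorfman u' v')].

Definition is_isomorphism (E E' : courant M) (I : forall p, E p -> E' p) :
    Prop := @is_equivalence E E' (fun p => p) I.

Definition is_gcs (E : courant M) (J : forall p, E p -> E p) : Prop :=
  [/\ smooth_endo J,
      forall p (u v : E p), csp (J p u) v = - csp u (J p v),
      forall p (u : E p), J p (J p u) = - u &
      forall u v u' v' : section E,
        smooth_section u -> smooth_section v ->
        smooth_section u' -> smooth_section v' ->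
        (forall p, in_i_eigenspace (J p) (u p) (v p)) ->
        (forall p, in_i_eigenspace (J p) (u' p) (v' p)) ->
        forall p, in_i_eigenspace (J p)
          (dorfman u u' p - dorfman v v' p) (dorfman u v' p + dorfman v u' p)].

Definition gcs_isomorphic (E : courant M) (J : forall p, E p -> E p)
    (E' : courant M) (J' : forall p, E' p -> E' p) : Prop :=
  exists I : forall p, E p -> E' p, is_isomorphism I /\
    forall p u, I p (J p u) = J' p (I p u).

Definition gcs_equivalent (E : courant M) (J : forall p, E p -> E p)
    (E' : courant M) (J' : forall p, E' p -> E' p) : Prop :=
  exists (phi : M -> M) (I : forall p, E p -> E' (phi p)),
    is_equivalence I /\ forall p u, I p (J p u) = J' (phi p) (I p u).

Definition std_nondegenerate (D : std_data M)
    (J : forall p, standard D p -> standard D p) : Prop :=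
  forall p, bijective
    (fun xi : cotangent M p => anchor (J p ((0, xi), 0)) : tangent M p).

Definition gcs_nondegenerate (E : courant M) (J : forall p, E p -> E p) : Prop :=
  exists (D : std_data M) (J' : forall p, standard D p -> standard D p),
    [/\ is_std_data D, gcs_isomorphic J J' & std_nondegenerate J'].

Definition J_can (G : qlie M)
    (nabla : forall p, tangent M p -> section G -> G p)
    (w : forall p, tangent M p -> tangent M p -> R)
    (A : forall p, G p -> G p) (p : M) (u : standard (untwisted nabla) p) :
    standard (untwisted nabla) p :=
  ((- (flat w p)^-1%VF u.1.2, flat w p u.1.1), A p u.2).

Definition is_canonical (G : qlie M)
    (nabla : forall p, tangent M p -> section G -> G p)
    (w : forall p, tangent M p -> tangent M p -> R)
    (A : forall p, G p -> G p) : Prop :=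
  [/\ is_std_data (untwisted nabla),
      symplectic w,
      smooth_endo A /\
      (forall p (a b : G p), qsp (A p a) b = - qsp a (A p b)),
      forall p v (s : section G), smooth_section s ->
        nabla p v (fun q => A q (s q)) = A p (nabla p v s) &
      (forall p (a : G p), A p (A p a) = - a) /\
      (forall p (a b a' b' : G p),
         in_i_eigenspace (A p) a b -> in_i_eigenspace (A p) a' b' ->
         in_i_eigenspace (A p) (qbr a a' - qbr b b') (qbr a b' + qbr b a'))].

End Courant.

(* Main.v *)
From HB Require Import structures.
Require Import Defs.
From mathcomp Require Import all_boot all_order all_algebra.
From mathcomp Require Import all_classical all_reals all_analysis.
From mathcomp Require Import ring lra.

Set Implicit Arguments.
Unset Strict Implicit.
Unset Printing Implicit Defensive.

Import Order.TTheory GRing.Theory Num.Theory numFieldNormedType.Exports.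

Local Open Scope classical_set_scope.
Local Open Scope ring_scope.

(** The bracket of a 1-form with any section is a 1-form, and 1-forms commute.
If [J] is non-degenerate, then [J(T*M)] is an isotropic complement of the kernel
of the anchor, and the vanishing of the Nijenhuis tensor of [J] on two 1-forms
[xi], [eta] reads
  [J xi, J eta] = J ([J xi, eta] + [xi, J eta]),
where the argument of [J] on the right is a 1-form.  So [J(T*M)] is closed under
the bracket: the splitting [sigma X = - J (kappa X)] of the anchor, where
[kappa] is minus the inverse of the bivector [xi |-> anchor (J xi)], maps Lie
brackets to Dorfman brackets ([dorfman_splitting]), and the algebroid is
untwisted with respect to it.  Everything else follows from this.

The orthogonal complement of [J(T*M) + T*M] is [J]-invariant.  Projection to [G]
identifies it with [G] as a quadratic Lie algebra bundle; the inverse is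
[ortho]. With [w u v = kappa u v] and the endomorphism [reduced] of [G]
corresponding to [J], the structure becomes the sum of [J_w] and [reduced]
([assemble_J_can]).  The Courant axiom
  anchor u <v, t> = <[u, v], t> + <v, [u, t]>
with [t = sigma Z] gives the brackets of the invariant complement
([dorfman_splitting_ortho]) and, applied to the Nijenhuis identity for two
1-forms, [dw = 0] ([kappa_closed]).  The Jacobi identity gives flatness of the
connection [nabla + ad sigma_G], where [sigma_G] is the [G]-component of [sigma]
([shifted_nabla_flat]).  The Nijenhuis identity on a 1-form and a section of the
complement, or on two sections of the complement, says that [reduced] is
parallel and integrable ([shifted_nabla_reduced], [reduced_integrable]).

An equivalence [K] of two canonical structures maps the kernel of the anchor
onto the kernel of the anchor, hence T*M, its radical, onto T*M.  As [J] maps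
[u] to the 1-form [flat w u], and [J] and the pairing are preserved, [w] is the
pull-back of [w'] ([canonical_symplectic_unique]).

Two observations keep the calculus short.  The Courant axioms of [standard D]
are not computed from those of [D]: they hold in [E], and isomorphisms transport
them ([courant_calculus_iso]).  And a 1-form is determined by its pairings with
the sections [sigma Z] for smooth global [Z], so Lie derivatives of forms are
never expanded in a chart. The analysis that remains serves to pass between
vectors and global smooth sections: a bump function extends each vector to a
global section ([vbundle_enough_sections]), and Cramer's rule shows that the
inverse of a smooth bundle map is smooth ([smooth_section_inv]), as needed for
[kappa]. *)

(** * Linear algebra *)

Lemma linear_zero (R : pzRingType) (V W : lmodType R) (f : V -> W) : linear f -> f 0 = 0.
Proof. by move=> lf; have := lf (-1) 0 0; rewrite scaler0 addr0 scaleN1r addNr. Qed.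

Lemma linear_add (R : pzRingType) (V W : lmodType R) (f : V -> W) : linear f ->
  {morph f : u v / u + v}.
Proof. by move=> lf u v; rewrite -[u in LHS]scale1r lf scale1r. Qed.

Lemma linear_opp (R : pzRingType) (V W : lmodType R) (f : V -> W) : linear f ->
  {morph f : u / - u}.
Proof.
by move=> lf u; rewrite -[- u]addr0 -scaleN1r lf scaleN1r (linear_zero lf) addr0.
Qed.

Lemma linear_inverse (K : fieldType) (V W : lmodType K) (f : V -> W) (g : W -> V) :
  linear f -> cancel f g -> cancel g f -> linear g.
Proof. by move=> lf fK gK a u v; apply: (can_inj fK); rewrite lf !gK. Qed.

Lemma fibrewise_inverse (T : Type) (X Y : T -> Type) (I : forall p, X p -> Y p) :
  (forall p, bijective (I p)) ->
  exists K : forall p, Y p -> X p,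
    (forall p, cancel (I p) (K p)) /\ (forall p, cancel (K p) (I p)).
Proof.
move=> bi.
have ex p : exists K : Y p -> X p, cancel (I p) K /\ cancel K (I p).
  by have [K IK KI] := bi p; exists K.
exists (fun p => sval (cid (ex p))).
by split=> p; have [] := svalP (cid (ex p)).
Qed.

Lemma linfun_linear (R : fieldType) (V W : vectType R) (f : V -> W) :
  linear f -> forall v, linfun f v = f v.
Proof.
move=> lf v; pose g : {linear V -> W} := HB.pack f (GRing.isLinear.Build _ _ _ _ f lf).
exact: (lfunE g v).
Qed.

Lemma linfun0 (K : fieldType) (U V : vectType K) : linfun (fun _ : U => 0 : V) = 0.
Proof. by apply/lfunP => v; rewrite linfun_linear ?lfunE // => a x y; rewrite scaler0 addr0. Qed.

(** All frames below come with explicit dual functionals; this lemma gives the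
basis property and the value of [coord] at once. *)
Lemma basis_by_coord (K : fieldType) (V : vectType K) k (X : k.-tuple V)
    (c : 'I_k -> V -> K) :
  (forall i, linear (c i : V -> K^o)) ->
  (forall v, v = \sum_i c i v *: tnth X i) ->
  (forall i j, c i (tnth X j) = (i == j)%:R) ->
  basis_of fullv X /\ forall i v, coord X i v = c i v.
Proof.
move=> cl cX cd.
have c0 i : c i 0 = 0 := linear_zero (cl i).
have clin i (a : 'I_k -> K) : c i (\sum_j a j *: tnth X j) = a i.
  have -> : c i (\sum_j a j *: tnth X j) = \sum_j a j * c i (tnth X j).
    elim: (index_enum _) => [|j r IH]; first by rewrite !big_nil.
    by rewrite !big_cons cl IH.
  rewrite (bigD1 i) //= cd eqxx mulr1 big1 ?addr0 // => j ji.
  by rewrite cd eq_sym (negbTE ji) mulr0.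
have fX : free X.
  apply/freeP => a a0 i; rewrite -(clin i a).
  rewrite (_ : \sum_j _ = 0) // -[RHS]a0.
  by apply: eq_bigr => j _; rewrite (tnth_nth 0).
split.
  rewrite /basis_of fX andbT eqEsubv subvf /=; apply/subvP => v _.
  rewrite (cX v); apply: memv_suml => i _; apply: memvZ; apply: memv_span.
  exact: mem_tnth.
move=> i v; rewrite {1}(cX v).
have -> : \sum_j c j v *: tnth X j = \sum_j c j v *: X`_j.
  by apply: eq_bigr => j _; rewrite (tnth_nth 0).
by rewrite coord_sum_free.
Qed.

(** * Functions of class C^k *)

(** The derivative of [f] at [x] also satisfies the defining expansion of [g],
as [f] and [g] have the same germ. *)
Lemma near_eq_differentiable (R : realType) (V W : normedModType R)
    (f g : V -> W) (x : V) :
  (\near x, f x = g x) -> differentiable f x -> differentiable g x.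
Proof.
move=> fg df; have fgx : f x = g x by exact: (nbhs_singleton fg).
have fg0 : \forall h \near (0 : V), f (h + x) = g (h + x).
  by move: fg; rewrite (near_shift 0 x) /= subr0.
have key : g \o shift x = cst (g x) + 'd f x +o_ (0 : V) id.
  apply/eqaddoP => e e0; move/diff_locallyP : (df) => [_ /eqaddoP /(_ e e0)].
  apply: filterS2 fg0 => h fgh.
  suff -> : (g \o shift x - (cst (g x) + 'd f x)) h =
            (f \o shift x - (cst (f x) + 'd f x)) h by [].
  by rewrite /= !fctE /= fgx fgh.
have dc : continuous ('d f x) by exact: diff_continuous.
by apply/diff_locallyP; rewrite (diff_unique dc key).
Qed.

Section Ck.
Variables (R : realType) (n : nat).
Implicit Types (U : set 'rV[R]_n) (f g : 'rV[R]_n -> R).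

Lemma CkW k U f : Ck k.+1 U f -> Ck k U f.
Proof.
elim: k f => [|k IH] f [df Df].
  by move=> x Ux; apply: differentiable_continuous; exact: df.
by split=> // v; apply: IH; exact: Df.
Qed.

Lemma Ck_sub k U V f : V `<=` U -> Ck k U f -> Ck k V f.
Proof.
move=> VU; elim: k f => [|k IH] f.
  by move=> cf x Vx; apply: cf; exact: VU.
by move=> [df Df]; split=> [x /VU|v]; [exact: df | apply: IH; exact: Df].
Qed.

(** The class C^k is a condition at each point, since the iterated derivatives
['D_v f] are functions on the whole space.  This makes smoothness a local
property. *)
Lemma Ck_pointwise k U f : (forall x, U x -> Ck k [set x] f) -> Ck k U f.
Proof.
elim: k f => [|k IH] f H; first by move=> x Ux; exact: (H x Ux).
split=> [x Ux|v]; first by have [+ _] := H x Ux; apply.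
by apply: IH => x Ux; have [_] := H x Ux; apply.
Qed.

Lemma Ck_eq k U f g : open U -> (forall x, U x -> f x = g x) ->
  Ck k U f -> Ck k U g.
Proof.
move=> oU; elim: k f g => [|k IH] f g fg.
  move=> cf x Ux; have := cf x Ux; rewrite /prop_for /continuous_at (fg x Ux).
  have fgn : {near x, f =1 g} by apply: filterS fg _; exact: open_nbhs_nbhs.
  move=> cfx; exact: (cvg_trans (near_eq_cvg fgn) cfx).
have fgn x : U x -> \near x, f x = g x.
  by move=> Ux; apply: filterS fg _; exact: open_nbhs_nbhs.
move=> [df Df]; split=> [x Ux|v].
  exact: near_eq_differentiable (fgn x Ux) (df x Ux).
apply: (IH _ _ _ (Df v)) => x Ux; exact: near_eq_derive (fgn x Ux).
Qed.

Lemma Ck_cst k U (a : R) : Ck k U (fun=> a).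
Proof.
elim: k a => [|k IH] a; first by move=> x _; apply: cst_continuous.
split=> [x _|v]; first exact: differentiable_cst.
have -> : 'D_v (fun=> a : R) = (fun=> 0) :> ('rV[R]_n -> R).
  by apply/funext => x; exact: derive_cst.
exact: IH.
Qed.

Lemma CkD k U f g : open U -> Ck k U f -> Ck k U g ->
  Ck k U (fun x => f x + g x).
Proof.
move=> oU; elim: k f g => [|k IH] f g.
  by move=> cf cg x Ux; exact: (continuousD (cf x Ux) (cg x Ux)).
move=> [df Df] [dg Dg]; split=> [x Ux|v].
  by apply: differentiableD; [exact: (df x Ux) | exact: (dg x Ux)].
apply: (@Ck_eq _ _ (fun x => 'D_v f x + 'D_v g x)) => //; last first.
  by apply: IH; [exact: Df | exact: Dg].
move=> x Ux; rewrite -deriveD //; apply: diff_derivable; (exact: df || exact: dg).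
Qed.

Lemma CkM k U f g : open U -> Ck k U f -> Ck k U g ->
  Ck k U (fun x => f x * g x).
Proof.
move=> oU; elim: k f g => [|k IH] f g.
  by move=> cf cg x Ux; exact: (continuousM (cf x Ux) (cg x Ux)).
move=> Cf Cg; have [df Df] := Cf; have [dg Dg] := Cg; split=> [x Ux|v].
  by apply: differentiableM; [exact: df | exact: dg].
apply: (@Ck_eq _ _ (fun x => f x * 'D_v g x + g x * 'D_v f x)) => //.
  move=> x Ux; rewrite -[RHS]/('D_v (f * g) x) deriveM //;
    by apply: diff_derivable; (exact: df || exact: dg).
by apply: CkD => //; apply: IH => //; exact: CkW || exact: Dg || exact: Df.
Qed.

Lemma CkV k U f : open U -> (forall x, U x -> f x != 0) -> Ck k U f ->
  Ck k U (fun x => (f x)^-1).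
Proof.
move=> oU f0; elim: k => [|k IH].
  by move=> cf x Ux; exact: (continuousV (f0 x Ux) (cf x Ux)).
move=> Cf; have [df Df] := Cf; split=> [x Ux|v].
  by apply: differentiableV; [exact: df | exact: f0].
pose g x := (f x)^-1.
have Cg : Ck k U g by apply: IH; exact: CkW.
apply: (@Ck_eq _ _ (fun x => -1 * (g x * g x) * 'D_v f x)) => //.
  move=> x Ux; rewrite deriveV ?f0 //; last by apply: diff_derivable; exact: df.
  by rewrite /g -exprVn expr2 mulN1r.
apply: CkM => //; last exact: Df.
by apply: CkM => //; [exact: Ck_cst | exact: CkM].
Qed.

(** The family [hs] plays the role of a smooth function [hs 0] of one variable
with its successive derivatives, so that the induction can move from [hs j] to
[hs j.+1]. *)
Lemma Ck_comp_real (hs : nat -> R -> R) k j U f : open U ->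
  (forall i (t : R), is_derive t 1 (hs i) (hs i.+1 t)) ->
  Ck k U f -> Ck k U (fun x => hs j (f x)).
Proof.
move=> oU dh; have ddh i t : differentiable (hs i) t.
  by apply/derivable1_diffP; apply: ex_derive.
elim: k j f => [|k IH] j f.
  move=> cf x Ux; apply: (@continuous_comp _ _ _ f (hs j)); first exact: cf.
  by apply: differentiable_continuous; exact: ddh.
move=> Cf; have [df Df] := Cf; split=> [x Ux|v].
  by apply: (@differentiable_comp _ _ _ _ f (hs j)); [exact: df | exact: ddh].
apply: (@Ck_eq _ _ (fun x => hs j.+1 (f x) * 'D_v f x)) => //.
  move=> x Ux; have dfx := df x Ux; rewrite -[RHS]/('D_v (hs j \o f) x).
  rewrite !deriveE //; last exact: differentiable_comp.
  rewrite (diff_comp dfx (ddh j (f x))) /=.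
  have dE y : 'd (hs j) (f x) y = hs j.+1 (f x) * y.
    rewrite deriv1E; last exact: ex_derive.
    by rewrite derive1E derive_val [LHS]mulrC.
  by rewrite dE.
by apply: CkM => //; [apply: IH => //; exact: CkW | exact: Df].
Qed.

End Ck.

Lemma compact_box (R : realType) n (x0 : 'rV[R]_n) (s : R) :
  compact [set v : 'rV[R]_n | forall i, `|v 0 i - x0 0 i| <= s].
Proof.
have H i : compact ([set t : R | `|t - x0 0 i| <= s] : set (R : ptopologicalType)).
  have -> : [set t : R | `|t - x0 0 i| <= s] = [set` `[x0 0 i - s, x0 0 i + s]].
    by apply/seteqP; split=> t /=; rewrite in_itv /= ler_distl.
  exact: segment_compact.
exact: (rV_compact H).
Qed.

(** * A smooth cutoff function *)

Section SmoothCutoff.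
Variable R : realType.

(** The functions [P (1/t) exp (-1/t)] for [t > 0], extended by 0, form a family
closed under differentiation, which contains the standard cutoff [P = 1]. *)
Definition flat_exp (P : {poly R}) (t : R) : R :=
  if 0 < t then P.[t^-1] * expR (- t^-1) else 0.

(** Here [exp u >= u^(m+2) / (m+2)!] beats [P(u) = O(u^m)] at [u = 1/t] by a
factor [t^2]; one [t] makes the function differentiable at 0, the other makes
the derivative vanish there. *)
Lemma flat_exp_bound (P : {poly R}) :
  exists C, forall t, 0 < t <= 1 -> `|flat_exp P t| <= C * t ^+ 2.
Proof.
set m := size P; exists ((\sum_(i < m) `|P`_i|) * (m.+2)`!%:R) => t /andP[t0 t1].
rewrite /flat_exp t0 normrM (gtr0_norm (expR_gt0 _)).
set u := t^-1; have u1 : 1 <= u by rewrite invf_ge1.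
have u0 : 0 < u by rewrite invr_gt0.
have HP : `|P.[u]| <= (\sum_(i < m) `|P`_i|) * u ^+ m.
  rewrite horner_coef mulr_suml; apply: le_trans (ler_norm_sum _ _ _) _.
  apply: ler_sum => i _; rewrite normrM ler_wpM2l // normrX gtr0_norm //.
  by apply: ler_weXn2l => //; exact: ltnW.
have HE : expR (- u) <= (m.+2)`!%:R * t ^+ m.+2.
  rewrite expRN -[leRHS]invrK; rewrite lef_pV2 ?posrE ?expR_gt0 //; last first.
    by rewrite invr_gt0 mulr_gt0 ?exprn_gt0 // ltr0n fact_gt0.
  apply: le_trans (expR_ge1Dxn m.+1 (ltW u0)).
  by rewrite invfM mulrC exprVn lerDr.
apply: le_trans (ler_pM _ _ HP HE) _ => //.
rewrite -!mulrA ler_wpM2l ?sumr_ge0 //.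
rewrite (mulrCA (u ^+ m)) ler_wpM2l // -addn2 exprD mulrA /u exprVn.
by rewrite mulVf ?mul1r // expf_neq0 // gt_eqF.
Qed.

Lemma is_derive_flat_exp (P : {poly R}) (t : R) :
  is_derive t 1 (flat_exp P) (flat_exp ('X^2 * (P - P^`())) t).
Proof.
have [t0|t0|->] := ltgtP t 0.
- have -> : flat_exp ('X^2 * (P - P^`())) t = 0 by rewrite /flat_exp (lt_gtF t0).
  apply: (@near_eq_is_derive _ _ _ (cst 0)).
  near=> s; rewrite /flat_exp lt_gtF //.
  by near: s; exact: lt_nbhsl.
- have tn0 : t != 0 by rewrite gt_eqF.
  have dV : is_derive t 1 (fun s : R => s^-1) (- t ^- 2).
    apply: DeriveDef; first exact: derivableV.
    by rewrite deriveV // derive_id [LHS]mulr1.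
  have dP : is_derive t 1 (fun s : R => P.[s^-1]) (P^`().[t^-1] * - t ^- 2).
    exact: (@is_derive1_comp _ (horner P) (fun s => s^-1) t _ _ _ dV).
  have dE : is_derive t 1 (fun s : R => expR (- s^-1)) (expR (- t^-1) * t ^- 2).
    have dN : is_derive t 1 (fun s : R => - s^-1) (t ^- 2).
      by rewrite -[t ^- 2]opprK; exact: is_deriveN.
    exact: (@is_derive1_comp _ expR (fun s => - s^-1) t _ _ _ dN).
  have -> : flat_exp ('X^2 * (P - P^`())) t =
      P.[t^-1] *: (expR (- t^-1) * t ^- 2) +
      expR (- t^-1) *: (P^`().[t^-1] * - t ^- 2).
    rewrite /flat_exp t0 !hornerE /= /GRing.scale /= exprVn; ring.
  apply: (near_eq_is_derive _ (is_deriveM dP dE)).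
  near=> s; rewrite /flat_exp ifT //.
  by near: s; exact: lt_nbhsr.
- have -> : flat_exp ('X^2 * (P - P^`())) 0 = 0 by rewrite /flat_exp ltxx.
  have [C HC] := flat_exp_bound P.
  have f0 : flat_exp P 0 = 0 by rewrite /flat_exp ltxx.
  suff cv : h^-1 *: ((flat_exp P \o shift 0) (h *: 1) - flat_exp P 0) @[h --> 0^'] --> (0 : R).
    by apply: DeriveDef; [apply/cvg_ex; exists 0 | exact: cvg_lim cv].
  apply/cvgrPdist_le => e e0.
  near=> h.
  have h0 : h != 0 by near: h; exact: nbhs_dnbhs_neq.
  rewrite /= f0 subr0 addr0 sub0r normrN [h *: 1]mulr1.
  have [hp|hn] := ltP 0 h; last by rewrite /flat_exp le_gtF // scaler0 normr0 ltW.
  have h1 : 0 < h <= 1.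
    rewrite hp /=; apply: ltW; near: h; apply: nbhs_dnbhs; exact: lt_nbhsl.
  rewrite normrM normfV (gtr0_norm hp) mulrC ler_pdivrMr //.
  apply: le_trans (HC _ h1) _.
  rewrite expr2 mulrA ler_pM2r //.
  apply: le_trans (_ : (`|C| + 1) * h <= _).
    by rewrite ler_pM2r // (le_trans (ler_norm _)) // lerDl.
  rewrite mulrC -ler_pdivlMr ?ltr_wpDl //.
  by apply: ltW; near: h; apply: nbhs_dnbhs; apply: lt_nbhsl; rewrite divr_gt0 // ltr_wpDl.
Unshelve. all: by end_near. Qed.

Lemma smooth_cutoff : exists hs : nat -> R -> R,
  [/\ forall i (t : R), is_derive t 1 (hs i) (hs i.+1 t),
      forall t, 0 < t -> hs 0%N t != 0 & forall t, t <= 0 -> hs 0%N t = 0].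
Proof.
pose Q := fix Q k : {poly R} := if k is k'.+1 then 'X^2 * (Q k' - (Q k')^`()) else 1.
exists (fun k => flat_exp (Q k)); split.
- by move=> i t; exact: is_derive_flat_exp.
- by move=> t t0; rewrite /flat_exp t0 hornerC mul1r gt_eqF ?expR_gt0.
- by move=> t t0; rewrite /flat_exp le_gtF.
Qed.

End SmoothCutoff.

(** * Smooth functions on a manifold *)

Section SmoothOn.
Variables (R : realType) (M : manifold R).
Implicit Types (U V : set M) (f g : M -> R).
Notation n := (mdim M).

Lemma chart_image_open (c : chart R M n) U :
  atlas c -> open U -> open (cfun c @` (U `&` cdom c)).
Proof.
move=> /atlas_chart [od oi cK _ ci] oU.
rewrite openE => _ [q [Uq cq] <-]; rewrite /interior.
have im : (cfun c @` cdom c) (cfun c q) by exists q.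
have n1 : nbhs (cfun c q) (cfun c @` cdom c) by exact: open_nbhs_nbhs.
have n2 : nbhs (cfun c q) (cinv c @^-1` U).
  by apply: (ci _ im); rewrite cK //; exact: open_nbhs_nbhs.
apply: filterS2 n1 n2 => x [q' cq' <-]; rewrite /preimage /= cK // => Uq'.
by exists q'.
Qed.

Lemma smooth_on_sub U V f : V `<=` U -> smooth_on U f -> smooth_on V f.
Proof.
move=> VU sf c ac k; apply: Ck_sub (sf c ac k) => _ [q [Vq cq] <-].
by exists q => //; split => //; exact: VU.
Qed.

Lemma smooth_on_local U f :
  (forall p, U p -> exists V, [/\ open V, V p & smooth_on V f]) ->
  smooth_on U f.
Proof.
move=> H c ac k; apply: Ck_pointwise => _ [q [Uq cq] <-].
have [V [_ Vq sV]] := H q Uq; apply: Ck_sub (sV c ac k) => _ ->.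
by exists q.
Qed.

Lemma smooth_on_eq U f g : open U -> (forall p, U p -> f p = g p) ->
  smooth_on U f -> smooth_on U g.
Proof.
move=> oU fg sf c ac k; apply: Ck_eq (sf c ac k).
  exact: chart_image_open.
have [_ _ cK _ _] := atlas_chart ac.
by move=> _ [q [Uq cq] <-]; rewrite cK //; exact: fg.
Qed.

Lemma smooth_on_cst U (a : R) : smooth_on U (fun=> a).
Proof. by move=> c ac k; exact: Ck_cst. Qed.

Lemma smooth_onD U f g : open U -> smooth_on U f -> smooth_on U g ->
  smooth_on U (fun p => f p + g p).
Proof.
by move=> oU sf sg c ac k; apply: CkD (sf c ac k) (sg c ac k); exact: chart_image_open.
Qed.

Lemma smooth_onM U f g : open U -> smooth_on U f -> smooth_on U g ->
  smooth_on U (fun p => f p * g p).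
Proof.
by move=> oU sf sg c ac k; apply: CkM (sf c ac k) (sg c ac k); exact: chart_image_open.
Qed.

Lemma smooth_onV U f : open U -> (forall p, U p -> f p != 0) ->
  smooth_on U f -> smooth_on U (fun p => (f p)^-1).
Proof.
move=> oU f0 sf c ac k; apply: CkV (sf c ac k); first exact: chart_image_open.
have [_ _ cK _ _] := atlas_chart ac.
by move=> _ [q [Uq cq] <-]; rewrite cK //; exact: f0.
Qed.

Lemma smooth_on_sum U (I : finType) (f : I -> M -> R) : open U ->
  (forall i, smooth_on U (f i)) -> smooth_on U (fun p => \sum_i f i p).
Proof.
move=> oU sf; elim: (index_enum I) => [|i r IH].
  rewrite (_ : (fun _ => _) = fun=> 0 : R); last by apply/funext => p; rewrite big_nil.
  exact: smooth_on_cst.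
rewrite (_ : (fun _ => _) = fun p => f i p + \sum_(j <- r) f j p); last first.
  by apply/funext => p; rewrite big_cons.
by apply: smooth_onD.
Qed.

Lemma smooth_on_prod U (I : finType) (f : I -> M -> R) : open U ->
  (forall i, smooth_on U (f i)) -> smooth_on U (fun p => \prod_i f i p).
Proof.
move=> oU sf; elim: (index_enum I) => [|i r IH].
  rewrite (_ : (fun _ => _) = fun=> 1 : R); last by apply/funext => p; rewrite big_nil.
  exact: smooth_on_cst.
rewrite (_ : (fun _ => _) = fun p => f i p * \prod_(j <- r) f j p); last first.
  by apply/funext => p; rewrite big_cons.
by apply: smooth_onM.
Qed.

Lemma smooth_on_det U m (A : M -> 'M[R]_m) : open U ->
  (forall i j, smooth_on U (fun p => A p i j)) ->
  smooth_on U (fun p => \det (A p)).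
Proof.
move=> oU sA; apply: smooth_on_sum => // s.
apply: smooth_onM => //; first exact: smooth_on_cst.
by apply: smooth_on_prod.
Qed.

Lemma smooth_on_invmx U m (A : M -> 'M[R]_m) : open U ->
  (forall p, U p -> \det (A p) != 0) ->
  (forall i j, smooth_on U (fun p => A p i j)) ->
  forall i j, smooth_on U (fun p => invmx (A p) i j).
Proof.
move=> oU d0 sA i j.
apply: (@smooth_on_eq _ (fun p => (\det (A p))^-1 * cofactor (A p) j i)) => //.
  by move=> p Up; rewrite /invmx unitmxE unitfE d0 // !mxE.
apply: smooth_onM => //; first by apply: smooth_onV => //; exact: smooth_on_det.
rewrite /cofactor; apply: smooth_onM => //; first exact: smooth_on_cst.
apply: smooth_on_det => // i' j'.
by under eq_fun do rewrite !mxE; exact: sA.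
Qed.

Lemma smooth_on_continuous U f p : open U -> U p -> smooth_on U f ->
  {for p, continuous f}.
Proof.
move=> oU Up sf; have [c [ac cp]] := atlas_cover p.
have [od _ cK cc _] := atlas_chart ac.
have H : {for p, continuous ((f \o cinv c) \o cfun c)}.
  apply: continuous_comp; first exact: cc.
  have im : (cfun c @` (U `&` cdom c)) (cfun c p) by exists p.
  exact: (sf c ac 0%N _ im).
rewrite /prop_for /continuous_at /= cK // in H.
apply: (cvg_trans _ H); apply: near_eq_cvg.
have np : nbhs p (cdom c) by exact: open_nbhs_nbhs.
by apply: filterS np => q cq /=; rewrite cK.
Qed.

Lemma smooth_on_neq0 U f p : open U -> U p -> smooth_on U f -> f p != 0 ->
  exists V, [/\ open V, V p, V `<=` U & forall q, V q -> f q != 0].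
Proof.
move=> oU Up sf f0; have cf := smooth_on_continuous oU Up sf.
have n0 : nbhs p [set q | f q != 0].
  have o0 : open [set t : R | t != 0] by exact: open_neq.
  have n0 : nbhs (f p) [set t : R | t != 0] by exact: open_nbhs_nbhs.
  exact: (cf _ n0).
have nU : nbhs p U by exact: open_nbhs_nbhs.
exists (interior (U `&` [set q | f q != 0])); split.
- exact: open_interior.
- by apply: filterI.
- by move=> q /interior_subset [].
- by move=> q /interior_subset [].
Qed.

Lemma smooth_on_chart (c : chart R M n) i : atlas c ->
  smooth_on (cdom c) (fun q => cfun c q 0 i).
Proof.
move=> ac c' ac' k; have := atlas_compatible ac' ac i k.
by rewrite setIC.
Qed.

(** The function vanishes off the preimage [K] of a compact box inside one
chart.  The compact set [K] is closed because [M] is Hausdorff, so the extension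
by 0 is smooth. *)
Lemma smooth_bump p U : open U -> U p -> exists rho : M -> R,
  [/\ smooth_fun rho, rho p = 1 &
      forall q, ~ U q -> exists V, [/\ open V, V q & forall r, V r -> rho r = 0]].
Proof.
move=> oU Up; have [c [ac cp]] := atlas_cover p.
have [od oi cK cc ci] := atlas_chart ac.
set W := U `&` cdom c; have oW : open W by exact: openI.
have /nbhs_ballP [r /= r0 rW] : nbhs (cfun c p) (cfun c @` W).
  by apply: open_nbhs_nbhs; split; [exact: chart_image_open | exists p].
pose s := r / 2; have s0 : 0 < s by rewrite divr_gt0.
set x0 := cfun c p.
pose box : set 'rV[R]_n := [set v | forall i, `|v 0 i - x0 0 i| <= s].
have boxW : box `<=` cfun c @` W.
  move=> v bv; apply: rW; split => // i j; rewrite ord1 /ball /= distrC.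
  by apply: le_lt_trans (bv j) _; rewrite /s ltr_pdivrMr // mulr_natr mulr2n ltrDl.
pose K := cinv c @` box.
have Kc : closed K.
  apply: compact_closed; first exact: mhausdorff.
  apply: continuous_compact; last exact: compact_box.
  apply: continuous_in_subspaceT => v /set_mem bv; apply: ci.
  by have [q [_ cq] qv] := boxW v bv; exists q.
have KW : K `<=` W.
  by move=> _ [v bv <-]; have [q [Uq cq] <-] := boxW v bv; rewrite cK.
have [hs [dh hp hn]] := smooth_cutoff R.
(* The cutoff is applied to [N], which is positive at [p] and nonpositive off the box. *)
pose N q := s ^+ 2 - \sum_i (cfun c q 0 i - x0 0 i) ^+ 2.
have Np : N p = s ^+ 2.
  by rewrite /N big1 ?subr0 // => i _; rewrite subrr expr0n.
pose a := hs 0%N (N p).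
have a0 : a != 0 by apply: hp; rewrite Np exprn_gt0.
pose rho q := if pselect (W q) then a^-1 * hs 0%N (N q) else 0.
have rho0 q : ~ K q -> rho q = 0.
  move=> nK; rewrite /rho; case: pselect => // -[Uq cq].
  have [Nq|Nq] := leP (N q) 0; first by rewrite hn ?mulr0.
  exfalso; apply: nK; exists (cfun c q); last by rewrite cK.
  move=> i; rewrite -ler_sqr ?nnegrE ?(ltW s0) // real_normK ?num_real //.
  apply: ltW; apply: le_lt_trans (_ : \sum_i (cfun c q 0 i - x0 0 i) ^+ 2 < _).
    by rewrite (bigD1 i) //= lerDl sumr_ge0 // => j _; exact: sqr_ge0.
  by move: Nq; rewrite /N subr_gt0.
exists rho; split.
- apply: smooth_on_local => q _; have [Wq|nWq] := pselect (W q).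
    exists W; split => //.
    apply: (@smooth_on_eq _ (fun q => a^-1 * hs 0%N (N q))) => //.
      by move=> q' Wq'; rewrite /rho; case: pselect.
    apply: smooth_onM => //; first exact: smooth_on_cst.
    move=> c' ac' k.
    apply: (@Ck_comp_real _ _ hs k 0 _ (fun x => N (cinv c' x)) _ dh).
      exact: chart_image_open.
    suff sN : smooth_on W N by exact: (sN c' ac' k).
    have -> : N = (fun q => s ^+ 2 + -1 * \sum_i (cfun c q 0 i + - x0 0 i) ^+ 2).
      by apply/funext => q'; rewrite /N mulN1r.
    apply: smooth_onD => //; first exact: smooth_on_cst.
    apply: smooth_onM => //; first exact: smooth_on_cst.
    apply: smooth_on_sum => // i.
    have sc : smooth_on W (fun q' => cfun c q' 0 i + - x0 0 i).
      apply: smooth_onD => //; last exact: smooth_on_cst.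
      apply: smooth_on_sub (smooth_on_chart i ac); exact: subIsetr.
    exact: smooth_onM.
  exists (~` K); split; first exact: closed_openC.
    by move=> /KW.
  apply: (@smooth_on_eq _ (fun=> 0)); last exact: smooth_on_cst.
    exact: closed_openC.
  by move=> q' /rho0.
- by rewrite /rho; case: pselect => [Wp|/(_ (conj Up cp))] //; rewrite mulVf.
- move=> q nUq; exists (~` K); split; first exact: closed_openC.
    by move=> /KW [].
  by move=> q' /rho0.
Qed.

End SmoothOn.

(** * Jacobians of chart transitions *)

Section Jacobian.
Variable R : realType.

Lemma differentiable_rV (V : normedModType R) m (g : V -> 'rV[R]_m) (x : V) :
  (forall i, differentiable (fun y => g y 0 i) x) -> differentiable g x.
Proof.
move=> dg.
have -> : g = \sum_(i < m) (fun y => g y 0 i *: delta_mx 0 i).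
  by apply/funext => y; rewrite fct_sumE [LHS]row_sum_delta.
by apply: differentiable_sum => i; apply: differentiableZl.
Qed.

Lemma jacobian_near_id m (h : 'rV[R]_m -> 'rV[R]_m) x :
  (\near x, h x = x) -> jacobian h x = 1%:M.
Proof.
move=> hx; have idh : \near x, x = h x by apply: filterS hx.
have dh : differentiable h x by apply: near_eq_differentiable idh _.
apply/row_matrixP => i; rewrite !rowE mulmx1.
by rewrite -deriveEjacobian // (near_eq_derive _ hx) derive_id.
Qed.

Lemma jacobian_comp m k l (f : 'rV[R]_m -> 'rV[R]_k) (g : 'rV[R]_k -> 'rV[R]_l) x :
  differentiable f x -> differentiable g (f x) ->
  jacobian (g \o f) x = jacobian f x *m jacobian g (f x).
Proof.
move=> df dg; have dgf := differentiable_comp df dg.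
apply/row_matrixP => i; rewrite !rowE mulmxA.
rewrite -deriveEjacobian // -[in RHS]deriveEjacobian // -deriveEjacobian //.
by rewrite !deriveE // diff_comp.
Qed.

End Jacobian.

Section Charts.
Variables (R : realType) (M : manifold R).
Notation n := (mdim M).

Lemma chart_at_atlas (p : M) : atlas (chart_at p).
Proof. by rewrite /chart_at; case: cid => c []. Qed.

Lemma chart_at_dom (p : M) : cdom (chart_at p) p.
Proof. by rewrite /chart_at; case: cid => c []. Qed.

Lemma cfunK (c : chart R M n) q : atlas c -> cdom c q -> cinv c (cfun c q) = q.
Proof. by move=> /atlas_chart [_ _ cK _ _]; exact: cK. Qed.

Lemma cdom_open (c : chart R M n) : atlas c -> open (cdom c).
Proof. by move=> /atlas_chart []. Qed.

Lemma near_chart (c : chart R M n) (U : set M) q :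
  atlas c -> open U -> U q -> cdom c q ->
  \forall x \near cfun c q, exists q', [/\ U q', cdom c q' & cfun c q' = x].
Proof.
move=> ac oU Uq cq.
have : nbhs (cfun c q) (cfun c @` (U `&` cdom c)).
  by apply: open_nbhs_nbhs; split; [exact: chart_image_open | exists q].
by apply: filterS => x [q' [Uq' cq'] <-]; exists q'.
Qed.

Lemma transition_differentiable (c c' : chart R M n) q :
  atlas c -> atlas c' -> cdom c q -> cdom c' q ->
  differentiable (cfun c' \o cinv c) (cfun c q).
Proof.
move=> ac ac' cq cq'; apply: differentiable_rV => i.
have [+ _] := atlas_compatible ac ac' i 1%N; apply.
by exists q.
Qed.

(** The chain rule for the composition of two transition maps, which is the
identity near the point. *)
Lemma transitionK (c c' : chart R M n) q :
  atlas c -> atlas c' -> cdom c q -> cdom c' q ->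
  transition c c' q *m transition c' c q = 1%:M.
Proof.
move=> ac ac' cq cq'; rewrite /transition.
have d1 := transition_differentiable ac ac' cq cq'.
have d2 := transition_differentiable ac' ac cq' cq.
have e : cfun c' q = (cfun c' \o cinv c) (cfun c q) by rewrite /= cfunK.
rewrite e -jacobian_comp //; last by rewrite -e.
apply: jacobian_near_id; have := near_chart ac (cdom_open ac') cq' cq.
by apply: filterS => x [q' [c'q' cq'' <-]] /=; rewrite !cfunK.
Qed.

Lemma dmap_id (p : M) (v : tangent M p) : @dmap R M M (fun q => q) p v = v.
Proof.
rewrite /dmap jacobian_near_id ?mulmx1 //.
have := near_chart (chart_at_atlas p) (cdom_open (chart_at_atlas p))
          (chart_at_dom p) (chart_at_dom p).
by apply: filterS => x [q' [_ cq' <-]] /=; rewrite cfunK //; exact: chart_at_atlas.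
Qed.

Lemma diffeomorphism_id : @diffeomorphism R M M (fun q => q).
Proof.
have si : @smooth_map R M M (fun q => q).
  by split=> [x //|c c' ac ac' i]; exact: atlas_compatible.
by exists (fun q => q).
Qed.

Lemma vder_cst (p : M) (v : tangent M p) (a : R) : vder v (fun=> a) = 0.
Proof. exact: (derive_cst (a : R^o)). Qed.

End Charts.

(** * Frames and smooth sections *)

Section Bundles.
Variables (R : realType) (M : manifold R).
Implicit Types V W : vbundle M.
Notation n := (mdim M).

(** The part of [is_vbundle] that does not mention transition functions.  It is
what is needed to compute with smooth sections, and it passes to duals and sums
without differentiating transition maps. *)
Definition framed V : Prop :=
  (forall p, exists e, frames (v := V) e /\ fdom e p) /\
  (forall e, frames (v := V) e -> open (fdom e) /\
     forall p, fdom e p -> basis_of fullv (fbasis e p)).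

Lemma vbundle_framed V : is_vbundle V -> framed V.
Proof. by case. Qed.

Lemma chart_frame_basis (c : chart R M n) p : atlas c -> cdom c p ->
  basis_of fullv (fbasis (chart_frame c) p).
Proof.
move=> ac cp; have a' := @chart_at_atlas R M p; have d' := @chart_at_dom R M p.
pose co i (v : 'rV[R]_n) : R := (v *m transition (chart_at p) c p) 0 i.
have [|||] // := @basis_by_coord R ('rV[R]_n : vectType R) _ (fbasis (chart_frame c) p) co.
- by move=> i a u v; rewrite /co mulmxDl -scalemxAl !mxE.
- move=> v; under eq_bigr do rewrite tnth_mktuple scalemxAl.
  rewrite -mulmx_suml /co -row_sum_delta -mulmxA transitionK ?mulmx1 //.
- by move=> i j; rewrite tnth_mktuple /co -mulmxA transitionK // mulmx1 mxE eqxx andTb.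
Qed.

Lemma tangent_framed : framed (tangent M).
Proof.
split=> [p|_ [c ac <-]].
  exists (chart_frame (chart_at p)); split; last exact: chart_at_dom.
  by exists (chart_at p) => //; exact: chart_at_atlas.
by split; [exact: cdom_open | move=> p; exact: chart_frame_basis].
Qed.

Lemma dual_frame_coord V (e : frame V (vrank V)) p :
  basis_of fullv (fbasis e p) ->
  basis_of fullv (fbasis (dual_frame e) p) /\
  forall i (x : 'Hom(V p, R^o)),
    coord (fbasis (dual_frame e) p) i x = x (tnth (fbasis e p) i).
Proof.
move=> be.
have coordE (v : V p) : v = \sum_i coord (fbasis e p) i v *: tnth (fbasis e p) i.
  rewrite {1}(coord_basis be (memvf v)).
  by apply: eq_bigr => i _; rewrite (tnth_nth 0).
apply: (@basis_by_coord R ('Hom(V p, R^o) : vectType R) _ _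
   (fun i x => x (tnth (fbasis e p) i))).
- by move=> i a x y; rewrite /= !lfunE /= !lfunE.
- move=> x; apply/lfunP => v; rewrite [in LHS](coordE v) linear_sum sum_lfunE.
  apply: eq_bigr => i _; rewrite linearZ /= tnth_mktuple !lfunE /= lfunE /=.
  by rewrite [LHS]mulrC.
- move=> i j; rewrite tnth_mktuple lfunE /= (tnth_nth 0) coord_free //.
  exact: basis_free be.
Qed.

Lemma dual_framed V : framed V -> framed (dual V).
Proof.
move=> [cv bs]; split=> [p|_ [e fe <-]].
  have [e [fe ep]] := cv p; exists (dual_frame e); split=> //; by exists e.
have [oe be] := bs e fe; split=> // p ep.
by have [] := dual_frame_coord (be p ep).
Qed.

Lemma cotangent_framed : framed (cotangent M).
Proof. exact: dual_framed tangent_framed. Qed.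

Lemma sum_frame_coord V W (e : frame V (vrank V)) (e' : frame W (vrank W)) p :
  basis_of fullv (fbasis e p) -> basis_of fullv (fbasis e' p) ->
  basis_of fullv (fbasis (sum_frame e e') p) /\
  forall x,
    (forall i, coord (fbasis (sum_frame e e') p) (lshift _ i) x
      = coord (fbasis e p) i x.1) /\
    (forall i, coord (fbasis (sum_frame e e') p) (rshift _ i) x
      = coord (fbasis e' p) i x.2).
Proof.
move=> be be'.
pose co (i : 'I_(vrank V + vrank W)) (x : V p * W p) : R :=
  match fintype.split i with
  | inl j => coord (fbasis e p) j x.1
  | inr j => coord (fbasis e' p) j x.2
  end.
have tl i : tnth (fbasis (sum_frame e e') p) (lshift _ i) = (tnth (fbasis e p) i, 0).
  by rewrite tnth_lshift tnth_map.
have tr i : tnth (fbasis (sum_frame e e') p) (rshift _ i) = (0, tnth (fbasis e' p) i).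
  by rewrite tnth_rshift tnth_map.
have sl i : fintype.split (lshift (vrank W) i) = inl i :> 'I_(vrank V) + 'I_(vrank W).
  exact: (unsplitK (inl _ i)).
have sr i : fintype.split (rshift (vrank V) i) = inr i :> 'I_(vrank V) + 'I_(vrank W).
  exact: (unsplitK (inr _ i)).
have [| | |bas coE] := @basis_by_coord R ((V p * W p)%type : vectType R) _
  (fbasis (sum_frame e e') p) co.
- by move=> i a x y; rewrite /co; case: fintype.split => j; rewrite linearP.
- move=> [x y]; rewrite big_split_ord /=.
  under eq_bigr do rewrite tl /co sl /=.
  under [X in _ + X]eq_bigr do rewrite tr /co sr /=.
  have ex : \sum_i coord (fbasis e p) i x *: (tnth (fbasis e p) i, 0 : W p) = (x, 0).
    rewrite [in RHS](coord_basis be (memvf x)).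
    under [in RHS]eq_bigr do rewrite -tnth_nth.
    by elim/big_rec2 : _ => // i u v _ ->; congr pair; rewrite /= scaler0 addr0.
  have ey : \sum_i coord (fbasis e' p) i y *: (0 : V p, tnth (fbasis e' p) i) = (0, y).
    rewrite [in RHS](coord_basis be' (memvf y)).
    under [in RHS]eq_bigr do rewrite -tnth_nth.
    by elim/big_rec2 : _ => // i u v _ ->; congr pair; rewrite /= scaler0 addr0.
  by rewrite ex ey; congr pair; rewrite /= ?addr0 ?add0r.
- move=> i j; rewrite -[i]splitK -[j]splitK.
  case: (fintype.split i) => i'; case: (fintype.split j) => j';
  rewrite /= ?tl ?tr /co ?sl ?sr /= ?linear0.
  + by rewrite eq_lshift (tnth_nth 0) coord_free 1?eq_sym ?(basis_free be).
  + by rewrite eq_lrshift.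
  + by rewrite eq_rlshift.
  + by rewrite eq_rshift (tnth_nth 0) coord_free 1?eq_sym ?(basis_free be').
split=> // x; split=> i; rewrite coE /co ?sl ?sr //.
Qed.

Lemma dsum_framed V W : framed V -> framed W -> framed (dsum V W).
Proof.
move=> [cv bv] [cw bw]; split=> [p|_ [e [e' [fe fe' ->]]]].
  have [e [fe ep]] := cv p; have [e' [fe' ep']] := cw p.
  by exists (sum_frame e e'); split; [exists e, e' | split].
have [oe be] := bv e fe; have [oe' be'] := bw e' fe'; split; first exact: openI.
by move=> p [ep ep']; have [] := sum_frame_coord (be p ep) (be' p ep').
Qed.

(** Frames of the second bundle cover the base, so smoothness of one component
in a frame can be tested locally in a frame of the sum. *)
Lemma smooth_section_dsum V W (s : section (dsum V W)) : framed V -> framed W ->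
  smooth_section s <->
  smooth_section (fun p => (s p).1 : V p) /\ smooth_section (fun p => (s p).2 : W p).
Proof.
move=> [cv bv] [cw bw]; split.
  move=> ss; split=> e fe i.
    have [oe be] := bv e fe; apply: smooth_on_local => p ep.
    have [e' [fe' ep']] := cw p; have [oe' be'] := bw e' fe'.
    exists (fdom e `&` fdom e'); split=> //; first exact: openI.
    have fee : frames (v := dsum V W) (sum_frame e e') by exists e, e'.
    have := ss _ fee (lshift _ i).
    apply: smooth_on_eq; first exact: openI.
    by move=> q [eq eq']; have [_ /(_ (s q)) [-> _]] := sum_frame_coord (be q eq) (be' q eq').
  have [oe be] := bw e fe; apply: smooth_on_local => p ep.
  have [e' [fe' ep']] := cv p; have [oe' be'] := bv e' fe'.
  exists (fdom e' `&` fdom e); split=> //; first exact: openI.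
  have fee : frames (v := dsum V W) (sum_frame e' e) by exists e', e.
  have := ss _ fee (rshift _ i).
  apply: smooth_on_eq; first exact: openI.
  by move=> q [eq' eq]; have [_ /(_ (s q)) [_ ->]] := sum_frame_coord (be' q eq') (be q eq).
move=> [s1 s2] _ [e [e' [fe fe' ->]]] i.
have [oe be] := bv e fe; have [oe' be'] := bw e' fe'.
have oee : open (fdom e `&` fdom e') by exact: openI.
rewrite -[i]splitK; case: (fintype.split i) => j /=.
  apply: (@smooth_on_eq _ _ _ (fun p => coord (fbasis e p) j (s p).1)) => //.
    by move=> q [eq eq']; have [_ /(_ (s q)) [-> _]] := sum_frame_coord (be q eq) (be' q eq').
  by apply: smooth_on_sub (s1 e fe j) => q [].
apply: (@smooth_on_eq _ _ _ (fun p => coord (fbasis e' p) j (s p).2)) => //.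
  by move=> q [eq eq']; have [_ /(_ (s q)) [_ ->]] := sum_frame_coord (be q eq) (be' q eq').
by apply: smooth_on_sub (s2 e' fe' j) => q [].
Qed.

Lemma section_ext V (s t : section V) : (forall p, s p = t p) -> s = t.
Proof. exact: functional_extensionality_dep. Qed.

Section Sections.
Variable V : vbundle M.
Hypothesis frV : framed V.

Lemma smooth_sectionD (s t : section V) : smooth_section s -> smooth_section t ->
  smooth_section (fun p => s p + t p).
Proof.
move=> ss st e fe i; have [oe be] := frV.2 e fe.
rewrite (_ : (fun _ => _) = fun p => coord (fbasis e p) i (s p) + coord (fbasis e p) i (t p)).
  by apply: smooth_onD => //; [exact: ss | exact: st].
by apply/funext => p; rewrite linearD.
Qed.

Lemma smooth_sectionZ (a : R) (s : section V) : smooth_section s ->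
  smooth_section (fun p => a *: s p).
Proof.
move=> ss e fe i; have [oe be] := frV.2 e fe.
rewrite (_ : (fun _ => _) = fun p => a * coord (fbasis e p) i (s p)).
  by apply: smooth_onM => //; [exact: smooth_on_cst | exact: ss].
by apply/funext => p; rewrite linearZ.
Qed.

Lemma smooth_sectionN (s : section V) : smooth_section s ->
  smooth_section (fun p => - s p).
Proof.
move=> ss; rewrite (_ : (fun _ => _) = fun p => (-1) *: s p).
  exact: smooth_sectionZ.
by apply: section_ext => p; rewrite scaleN1r.
Qed.

Lemma smooth_sectionB (s t : section V) : smooth_section s -> smooth_section t ->
  smooth_section (fun p => s p - t p).
Proof. by move=> ss st; apply: smooth_sectionD => //; exact: smooth_sectionN. Qed.

Lemma smooth_section0 : smooth_section (fun p => 0 : V p).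
Proof.
move=> e fe i; rewrite (_ : (fun _ => _) = fun=> 0); first exact: smooth_on_cst.
by apply/funext => p; rewrite linear0.
Qed.

End Sections.

(** Bundle maps and tensors are only known to be smooth on global sections, so
pointwise identities are obtained by extending vectors to such sections. *)
Definition enough_sections V : Prop :=
  forall p (u : V p), exists s : section V, smooth_section s /\ s p = u.

(** Multiply a combination of frame vectors with constant coefficients by a bump
function. *)
Lemma vbundle_enough_sections V : is_vbundle V -> enough_sections V.
Proof.
move=> [cv bv tv] p u; have [e [fe ep]] := cv p; have [oe be] := bv e fe.
have [rho [srho rhop rho0]] := smooth_bump oe ep.
pose a i := coord (fbasis e p) i u.
exists (fun q => rho q *: \sum_i a i *: tnth (fbasis e q) i); split; last first.
  rewrite rhop scale1r [RHS](coord_basis (be p ep) (memvf u)).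
  by apply: eq_bigr => i _; rewrite (tnth_nth 0).
move=> e' fe' j; have [oe' be'] := bv e' fe'.
apply: smooth_on_local => q e'q; have [eq|neq] := pselect (fdom e q).
  exists (fdom e `&` fdom e'); split=> //; first exact: openI.
  rewrite (_ : (fun _ => _) = fun q =>
      rho q * \sum_i a i * coord (fbasis e' q) j (tnth (fbasis e q) i)).
    apply: smooth_onM; first exact: openI.
      by apply: smooth_on_sub srho.
    apply: smooth_on_sum => [|i]; first exact: openI.
    apply: smooth_onM; [exact: openI | exact: smooth_on_cst | exact: tv].
  apply/funext => r; rewrite linearZ linear_sum; congr (_ * _).
  by apply: eq_bigr => i _; rewrite linearZ.
have [U [oU Uq U0]] := rho0 q neq; exists U; split=> //.
apply: (@smooth_on_eq _ _ _ (fun=> 0)) => //; last exact: smooth_on_cst.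
by move=> r Ur; rewrite U0 // scale0r linear0.
Qed.

(** Near [p], take global sections [s_i] of [V] such that the [L s_i] agree with
a frame of [W] at [p].  The matrix [A] of the [L s_i] in this frame is
invertible near [p], and [K t] is the combination of the [s_i] with coefficients
[t A^-1]. *)
Lemma smooth_section_inv V W (L : forall p, V p -> W p) (K : forall p, W p -> V p) :
  framed V -> framed W -> enough_sections V ->
  (forall p, linear (L p)) -> (forall p, cancel (L p) (K p)) ->
  (forall p, cancel (K p) (L p)) ->
  (forall s : section V, smooth_section s -> smooth_section (fun p => L p (s p) : W p)) ->
  forall t : section W, smooth_section t -> smooth_section (fun p => K p (t p) : V p).
Proof.
move=> frV frW en Ll LK KL Ls t st e fe j; have [oe be] := frV.2 e fe.
apply: smooth_on_local => p ep.
have [e' [fe' ep']] := frW.1 p; have [oe' be'] := frW.2 e' fe'.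
have /choice [s Hs] : forall i, exists s : section V,
    smooth_section s /\ s p = K p (tnth (fbasis e' p) i) by move=> i; exact: en.
pose A q : 'M[R]_(vrank W) := \matrix_(i, k) coord (fbasis e' q) k (L q (s i q)).
have sA i k : smooth_on (fdom e') (fun q => A q i k).
  rewrite (_ : (fun _ => _) = fun q => coord (fbasis e' q) k (L q (s i q))).
    by have [ss _] := Hs i; exact: (Ls _ ss).
  by apply/funext => q; rewrite mxE.
have Ap : A p = 1%:M.
  apply/matrixP => i k; rewrite !mxE; have [_ ->] := Hs i; rewrite KL.
  by rewrite (tnth_nth 0) coord_free 1?eq_sym ?(basis_free (be' p ep')).
have dA : smooth_on (fdom e') (fun q => \det (A q)) by exact: smooth_on_det.
have [U [oU Up Ue' dU]] : exists U, [/\ open U, U p, U `<=` fdom e' &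
    forall q, U q -> \det (A q) != 0].
  by apply: smooth_on_neq0 => //; rewrite Ap det1 oner_neq0.
exists (U `&` fdom e); split=> //; first exact: openI.
pose x q : 'rV[R]_(vrank W) := \row_k coord (fbasis e' q) k (t q).
pose f q := x q *m invmx (A q).
have L0 q : L q 0 = 0 := linear_zero (Ll q).
have Lsum q (a : 'I_(vrank W) -> R) (v : 'I_(vrank W) -> V q) :
    L q (\sum_i a i *: v i) = \sum_i a i *: L q (v i).
  elim: (index_enum _) => [|i r IH]; first by rewrite !big_nil.
  by rewrite !big_cons Ll IH.
have KE q : U q -> K q (t q) = \sum_i f q 0 i *: s i q.
  move=> Uq; apply: (can_inj (LK q)); rewrite KL Lsum.
  have bq := be' q (Ue' q Uq).
  rewrite [LHS](coord_basis bq (memvf _)) [in RHS](eq_bigr (fun i =>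
     \sum_k f q 0 i * A q i k *: (fbasis e' q)`_k)); last first.
    move=> i _; rewrite {1}(coord_basis bq (memvf (L q (s i q)))) scaler_sumr.
    by apply: eq_bigr => k _; rewrite scalerA [A q i k]mxE.
  rewrite exchange_big /=; apply: eq_bigr => k _; rewrite -scaler_suml.
  congr (_ *: _); have <- : (f q *m A q) 0 k = \sum_i f q 0 i * A q i k by rewrite mxE.
  by rewrite /f mulmxKV ?[RHS]mxE ?mxE // unitmxE unitfE dU.
have oUe : open (U `&` fdom e) by exact: openI.
apply: (@smooth_on_eq _ _ _ (fun q => \sum_i f q 0 i * coord (fbasis e q) j (s i q))) => //.
  move=> q [Uq eq]; rewrite KE // linear_sum; apply: eq_bigr => i _.
  by rewrite linearZ.
apply: smooth_on_sum => // i; apply: smooth_onM => //; last first.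
  by have [/(_ e fe j) ss _] := Hs i; apply: smooth_on_sub ss => q [].
rewrite (_ : (fun _ => _) = fun q => \sum_k x q 0 k * invmx (A q) k i); last first.
  by apply/funext => q; rewrite mxE.
have sUe : U `&` fdom e `<=` fdom e' by move=> q [/Ue'].
apply: smooth_on_sum => // k; apply: smooth_onM => //.
  rewrite (_ : (fun _ => _) = fun q => coord (fbasis e' q) k (t q)).
    exact: (smooth_on_sub sUe (st e' fe' k)).
  by apply/funext => q; rewrite mxE.
apply: (@smooth_on_sub _ _ U) => [q []|] //.
apply: smooth_on_invmx => // i' k'; exact: (smooth_on_sub Ue' (sA i' k')).
Qed.

End Bundles.

(** * Isomorphisms of Courant algebroids *)

Section Isomorphisms.
Variables (R : realType) (M : manifold R).
Implicit Types E : courant M.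

(** The differential of the identity is the identity, and push-forward by the
identity is composition with [I]. *)
Lemma isomorphismP E E' (I : forall p, E p -> E' p) :
  is_isomorphism I <->
  [/\ forall p, linear (I p), forall p, bijective (I p),
      forall s : section E,
        smooth_section s <-> smooth_section (fun p => I p (s p) : E' p),
      forall p u, anchor (I p u) = anchor u /\
        forall v, csp (I p u) (I p v) = csp u v &
      forall u v : section E, smooth_section u -> smooth_section v -> forall p,
        dorfman (fun q => I q (u q) : E' q) (fun q => I q (v q) : E' q) p
          = I p (dorfman u v p)].
Proof.
split.
  case=> _ [lb sm] an cs dr; split.
  - by move=> p; have [] := lb p.
  - by move=> p; have [] := lb p.
  - by move=> s; exact: sm.
  - by move=> p u; split=> [|v]; [rewrite an dmap_id | rewrite cs].
  - by move=> u v su sv; apply: dr.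
move=> [li bi sm ac dr]; split.
- exact: diffeomorphism_id.
- split=> [p|s s' ss']; first by split; [exact: li | exact: bi].
  have -> : s' = (fun p => I p (s p)) by exact: section_ext.
  exact: sm.
- by move=> p u; rewrite dmap_id; have [] := ac p u.
- by move=> p u v; have [_ ->] := ac p u.
- move=> u u' v v' su sv uu' vv'.
  have -> : u' = (fun p => I p (u p)) by exact: section_ext.
  have -> : v' = (fun p => I p (v p)) by exact: section_ext.
  exact: dr.
Qed.

Lemma gcs_isomorphic_sym E E' (J : forall p, E p -> E p) (J' : forall p, E' p -> E' p) :
  gcs_isomorphic J J' -> gcs_isomorphic J' J.
Proof.
move=> [I [/isomorphismP [li bi sm ac dr] JI]].
have [K [IK KI]] := fibrewise_inverse bi.
have sK (s : section E') : smooth_section s <-> smooth_section (fun p => K p (s p) : E p).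
  rewrite sm; suff -> : (fun p => I p (K p (s p))) = s by [].
  by apply: section_ext => p; rewrite KI.
exists K; split; last first.
  by move=> p u; apply: (can_inj (IK p)); rewrite JI !KI.
apply/isomorphismP; split=> //.
- by move=> p; exact: linear_inverse (li p) (IK p) (KI p).
- by move=> p; exists (I p).
- move=> p u; have [an cs] := ac p (K p u); split.
    by rewrite -an KI.
  by move=> v; rewrite -cs !KI.
- move=> u v /sK su /sK sv p; apply: (can_inj (IK p)); rewrite KI -dr //.
  by congr (dorfman _ _ p); apply: section_ext => q; rewrite KI.
Qed.

Lemma gcs_isomorphic_trans E E' E'' (J : forall p, E p -> E p)
    (J' : forall p, E' p -> E' p) (J'' : forall p, E'' p -> E'' p) :
  gcs_isomorphic J J' -> gcs_isomorphic J' J'' -> gcs_isomorphic J J''.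
Proof.
move=> [I [/isomorphismP [li bi sm ac dr] JI]].
move=> [I' [/isomorphismP [li' bi' sm' ac' dr'] JI']].
exists (fun p u => I' p (I p u)); split; last by move=> p u; rewrite JI JI'.
apply/isomorphismP; split=> //.
- by move=> p a u v; rewrite li li'.
- by move=> p; exact: bij_comp.
- by move=> s; rewrite sm sm'.
- move=> p u; have [an cs] := ac p u; have [an' cs'] := ac' p (I p u).
  by split=> [|v]; rewrite ?an' ?cs'.
- by move=> u v su sv p; rewrite dr' ?dr // -sm.
Qed.

(** The axioms of a Courant algebroid, with smoothness of the transition
functions replaced by the existence of global sections through each vector,
which isomorphisms preserve: they relate smooth sections, not frames. *)
Definition courant_calculus E : Prop :=
  [/\ framed E /\ enough_sections E,
      scalar_product (@csp _ _ E),
      (forall p, linear (@anchor _ _ E p)) /\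
      (forall s : section E, smooth_section s ->
         smooth_section (fun p => anchor (s p) : tangent M p)),
      (forall u v : section E, smooth_section u -> smooth_section v ->
         smooth_section (dorfman u v)) /\
      (forall (a : R) (u v w : section E),
         smooth_section u -> smooth_section v -> smooth_section w ->
         forall p,
         dorfman (fun q => a *: u q + v q) w p
           = a *: dorfman u w p + dorfman v w p /\
         dorfman w (fun q => a *: u q + v q) p
           = a *: dorfman w u p + dorfman w v p) &
      forall u v w : section E,
        smooth_section u -> smooth_section v -> smooth_section w ->
        forall p,
        [/\ dorfman u (dorfman v w) p
              = dorfman (dorfman u v) w p + dorfman v (dorfman u w) p,
            vder (anchor (u p)) (fun q => csp (v q) (w q))
              = csp (dorfman u v p) (w p) + csp (v p) (dorfman u w p) &
            csp (dorfman u v p + dorfman v u p) (w p)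
              = vder (anchor (w p)) (fun q => csp (u q) (v q))]].

Lemma courant_courant_calculus E : is_courant E -> courant_calculus E.
Proof.
by case=> vE; split=> //; split; [exact: vbundle_framed | exact: vbundle_enough_sections].
Qed.

(** Each smooth section of [E'] is the image of one of [E], and each axiom is an
identity between images. *)
Lemma courant_calculus_iso E E' (I : forall p, E p -> E' p) :
  framed E' -> is_isomorphism I -> courant_calculus E -> courant_calculus E'.
Proof.
move=> frE' /isomorphismP [li bi sm ac dr] [[frE en] [cl cc cn cs] [al as_] [ds dl] ax].
have [K [IK KI]] := fibrewise_inverse bi.
have an p u : anchor (I p u) = anchor u by have [] := ac p u.
have cp p u v : csp (I p u) (I p v) = csp u v by have [] := ac p u.
have [sK sE] : (forall s : section E', smooth_section s ->
    smooth_section (fun p => K p (s p) : E p)) /\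
    (forall s : section E', s = (fun p => I p (K p (s p)))).
  have e s : s = (fun p => I p (K p (s p))) by apply: section_ext => p; rewrite KI.
  by split=> // s; rewrite {1}(e s) -sm.
have dE (u v : section E) : smooth_section u -> smooth_section v ->
    dorfman (fun q => I q (u q) : E' q) (fun q => I q (v q) : E' q) =
    (fun p => I p (dorfman u v p)).
  by move=> su sv; apply: section_ext => p; exact: dr.
split.
- split=> // p u; have [s [ss sp]] := en p (K p u).
  by exists (fun q => I q (s q)); split; [apply/sm | rewrite sp KI].
- split.
  + by move=> p u a v w; rewrite -(KI p u) -(KI p v) -(KI p w) -li !cp cl.
  + by move=> p u v; rewrite -(KI p u) -(KI p v) !cp cc.
  + move=> p u u0; rewrite -(KI p u); have -> : K p u = 0.
      by apply: cn => v; rewrite -cp KI u0.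
    exact: linear_zero (li p).
  + move=> s t /sK ss /sK st; rewrite (sE s) (sE t).
    under eq_fun do rewrite cp.
    exact: (cs _ _ ss st).
- split.
  + by move=> p a u v; rewrite -(KI p u) -(KI p v) -li !an al.
  + move=> s /sK ss; rewrite (sE s).
    have -> : (fun p => anchor (I p (K p (s p)))) = (fun p => anchor (K p (s p))).
      by apply/funext => p; rewrite an.
    exact: (as_ _ ss).
- split.
  + by move=> u v /sK su /sK sv; rewrite (sE u) (sE v) dE //; apply/sm; exact: (ds _ _ su sv).
  + move=> a u v w /sK su /sK sv /sK sw p; rewrite (sE u) (sE v) (sE w).
    have -> : (fun q => a *: I q (K q (u q)) + I q (K q (v q))) =
       (fun q => I q (a *: K q (u q) + K q (v q))).
      by apply: section_ext => q; rewrite li.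
    have suv : smooth_section (fun q => a *: K q (u q) + K q (v q) : E q).
      by apply: smooth_sectionD => //; exact: smooth_sectionZ.
    rewrite !dE // -!li.
    by have [-> ->] := dl a _ _ _ su sv sw p.
- move=> u v w /sK su /sK sv /sK sw p; rewrite (sE u) (sE v) (sE w).
  have [j m s] := ax _ _ _ su sv sw p.
  have iD a b : I p (a + b) = I p a + I p b := linear_add (li p) a b.
  have suv := ds _ _ su sv; have suw := ds _ _ su sw; have svw := ds _ _ sv sw.
  rewrite !dE // !an !cp -!iD; split.
  + by rewrite j.
  + by under eq_fun do rewrite cp.
  + by under eq_fun do rewrite cp; rewrite cp.
Qed.

End Isomorphisms.

(** * Consequences of the Courant and integrability axioms *)

Section Calculus.
Variables (R : realType) (M : manifold R).

Lemma is_gcs_iso (E E' : courant M) (I : forall p, E p -> E' p)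
    (J : forall p, E p -> E p) (J' : forall p, E' p -> E' p) :
  is_isomorphism I -> (forall p u, I p (J p u) = J' p (I p u)) ->
  is_gcs J -> is_gcs J'.
Proof.
move=> /isomorphismP [li bi sm ac dr] JI [[Jl Js] sk sq int].
have [K [IK KI]] := fibrewise_inverse bi.
have cp p u v : csp (I p u) (I p v) = csp u v by have [] := ac p u.
have sE (s : section E') : s = (fun p => I p (K p (s p))).
  by apply: section_ext => p; rewrite KI.
have sK (s : section E') : smooth_section s -> smooth_section (fun p => K p (s p) : E p).
  by rewrite {1}(sE s) -sm.
have IN p a : I p (- a) = - I p a := linear_opp (li p) a.
have ID p a b : I p (a + b) = I p a + I p b := linear_add (li p) a b.
split.
- split=> [p a u v|s ss].
    by rewrite -(KI p u) -(KI p v) -li -!JI Jl li.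
  rewrite (sE s); have -> : (fun p => J' p (I p (K p (s p)))) = (fun p => I p (J p (K p (s p)))).
    by apply: section_ext => p; rewrite JI.
  by apply/sm; exact: (Js _ (sK _ ss)).
- by move=> p u v; rewrite -(KI p u) -(KI p v) -!JI !cp sk.
- by move=> p u; rewrite -(KI p u) -!JI sq IN.
- move=> u v u' v' /sK su /sK sv /sK su' /sK sv' e e' p.
  have eig (x y : section E') : (forall p, in_i_eigenspace (J' p) (x p) (y p)) ->
      forall p, in_i_eigenspace (J p) (K p (x p)) (K p (y p)).
    move=> exy q; have [ex ey] := exy q; split; apply: (can_inj (IK q)).
      by rewrite JI IN !KI.
    by rewrite JI !KI.
  have [i1 i2] := int _ _ _ _ su sv su' sv' (eig _ _ e) (eig _ _ e') p.
  rewrite (sE u) (sE v) (sE u') (sE v') !dr // -IN -!ID; split.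
    by rewrite -JI i1 IN.
  by rewrite -JI i2.
Qed.

Section Gcs.
Variables (E : courant M) (J : forall p, E p -> E p).
Hypotheses (cE : courant_calculus E) (gJ : is_gcs J).
Implicit Types u v w : section E.

Lemma dorfmanDl u v w p : smooth_section u -> smooth_section v -> smooth_section w ->
  dorfman (fun q => u q + v q) w p = dorfman u w p + dorfman v w p.
Proof.
move=> su sv sw; have [_ _ _ [_ /(_ 1 u v w su sv sw p) [+ _]] _] := cE.
by rewrite scale1r => <-; congr (dorfman _ _ p); apply: section_ext => q; rewrite scale1r.
Qed.

Lemma dorfmanDr u v w p : smooth_section u -> smooth_section v -> smooth_section w ->
  dorfman w (fun q => u q + v q) p = dorfman w u p + dorfman w v p.
Proof.
move=> su sv sw; have [_ _ _ [_ /(_ 1 u v w su sv sw p) [_ +]] _] := cE.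
by rewrite scale1r => <-; congr (dorfman _ _ p); apply: section_ext => q; rewrite scale1r.
Qed.

Let fE : framed E. Proof. by have [[]] := cE. Qed.

Lemma dorfmanNl u w p : smooth_section u -> smooth_section w ->
  dorfman (fun q => - u q) w p = - dorfman u w p.
Proof.
move=> su sw; have s0 := @smooth_section0 _ _ E; have sN := smooth_sectionN fE su.
have z : dorfman (fun q => 0 : E q) w p = 0.
  apply: (addIr (dorfman u w p)); rewrite add0r -dorfmanDl //.
  by congr (dorfman _ _ p); apply: section_ext => q; rewrite add0r.
apply/eqP; rewrite -addr_eq0 -dorfmanDl // -[X in _ == X]z.
by apply/eqP; congr (dorfman _ _ p); apply: section_ext => q; rewrite addNr.
Qed.

Lemma dorfmanNr u w p : smooth_section u -> smooth_section w ->
  dorfman w (fun q => - u q) p = - dorfman w u p.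
Proof.
move=> su sw; have s0 := @smooth_section0 _ _ E; have sN := smooth_sectionN fE su.
have z : dorfman w (fun q => 0 : E q) p = 0.
  apply: (addIr (dorfman w u p)); rewrite add0r -dorfmanDr //.
  by congr (dorfman _ _ p); apply: section_ext => q; rewrite add0r.
apply/eqP; rewrite -addr_eq0 -dorfmanDr // -[X in _ == X]z.
by apply/eqP; congr (dorfman _ _ p); apply: section_ext => q; rewrite addNr.
Qed.

(** For a section [u], the pair [(u, - J u)] represents the [i]-eigensection [u
- i J u].  The identity is the second component of integrability for two such
eigensections. *)
Lemma nijenhuis u v p : smooth_section u -> smooth_section v ->
  dorfman (fun q => J (u q)) (fun q => J (v q)) p - dorfman u v p
    = J (dorfman (fun q => J (u q)) v p + dorfman u (fun q => J (v q)) p).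
Proof.
move=> su sv; have [[Jl Js] _ sq int] := gJ.
have sJu := Js _ su; have sJv := Js _ sv.
have eig (x : section E) q : in_i_eigenspace (J (p := q)) (x q) (- J (x q)).
  split; first by rewrite opprK.
  by rewrite (linear_opp (Jl q)) sq opprK.
have sN := smooth_sectionN fE sJu; have sN' := smooth_sectionN fE sJv.
have [_] := int _ _ _ _ su sN sv sN' (eig u) (eig v) p.
rewrite !(dorfmanNl, dorfmanNr) // opprK => e.
rewrite -[LHS]opprK opprB -e.
by rewrite -opprD (linear_opp (Jl p)) opprK addrC.
Qed.

End Gcs.
End Calculus.

(** * The bracket of a standard Courant algebroid *)

Section StandardDorfman.
Variables (R : realType) (M : manifold R).

Lemma lie0r (X : vfield M) p : lie X (fun _ => 0) p = 0.
Proof.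
rewrite /lie derive0 subr0.
rewrite (_ : components _ _ = cst 0) ?derive_cst //.
by apply/funext => x; rewrite /components mul0mx.
Qed.

Lemma lie0l (X : vfield M) p : lie (fun _ => 0) X p = 0.
Proof.
rewrite /lie derive0 sub0r.
rewrite (_ : components _ _ = cst 0) ?derive_cst ?oppr0 //.
by apply/funext => x; rewrite /components mul0mx.
Qed.

Lemma lie_form0l (eta : section (cotangent M)) p : lie_form (fun _ => 0) eta p = 0.
Proof.
rewrite /lie_form -[RHS]linfun0; congr linfun; apply/funext => v.
by rewrite /vder derive0 lie0l linear0 subr0.
Qed.

Lemma dfun0 p : @dfun R M (fun=> 0) p = 0.
Proof.
by rewrite /dfun -[RHS]linfun0; congr linfun; apply/funext => v; rewrite vder_cst.
Qed.

Lemma connection0 (V : vbundle M) (D : forall p, tangent M p -> section V -> V p) p v :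
  is_connection D -> D p v (fun _ => 0) = 0.
Proof.
case=> _ add _ _; have s0 := @smooth_section0 _ _ V.
apply: (addIr (D p v (fun=> 0))); rewrite add0r -add //.
by congr (D p v _); apply: section_ext => q; rewrite addr0.
Qed.

Lemma connection_tangent0 (V : vbundle M) (D : forall p, tangent M p -> section V -> V p) p s :
  is_connection D -> smooth_section s -> D p 0 s = 0.
Proof. by case=> /(_ p s) lin _ _ _ ss; exact: linear_zero (lin ss). Qed.

End StandardDorfman.

Section StandardData.
Variables (R : realType) (M : manifold R) (D : std_data M).
Hypothesis sd : is_std_data D.
Notation G := (sG D).
Notation S := (standard D).
Notation T := (tangent M).
Notation C := (cotangent M).

Lemma std_qlie : is_qlie G. Proof. by case: sd. Qed.

Lemma std_connection : is_connection (@snabla _ _ D). Proof. by case: sd. Qed.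

Lemma std_G_framed : framed G.
Proof. by have [/vbundle_framed] := std_qlie. Qed.

Lemma std_framed : framed S.
Proof.
apply: dsum_framed; last exact: std_G_framed.
by apply: dsum_framed; [exact: tangent_framed | exact: cotangent_framed].
Qed.

Lemma smooth_std (s : section S) : smooth_section s <->
  [/\ smooth_section (fun p => (s p).1.1 : T p),
      smooth_section (fun p => (s p).1.2 : C p) &
      smooth_section (fun p => (s p).2 : G p)].
Proof.
have fT := @tangent_framed R M; have fC := @cotangent_framed R M.
have fTC := dsum_framed fT fC; have fG := std_G_framed.
split.
  move=> /(smooth_section_dsum _ fTC fG) [s1 s2].
  by have /(smooth_section_dsum _ fT fC) [] := s1.
move=> [s1 s2 s3]; apply/(smooth_section_dsum _ fTC fG); split=> //.
by apply/(smooth_section_dsum _ fT fC).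
Qed.

Lemma smooth_std_pair (X : section T) (xi : section C) (r : section G) :
  smooth_section X -> smooth_section xi -> smooth_section r ->
  smooth_section (fun p => ((X p, xi p), r p) : S p).
Proof. by move=> sX sxi sr; apply/smooth_std. Qed.

Lemma qbrl p (a : G p) : linear (@qbr _ _ G p ^~ a).
Proof. by have [_ _ _ /(_ p a) []] := std_qlie. Qed.

Lemma qbrr p (a : G p) : linear (qbr a).
Proof. by have [_ _ _ /(_ p a) []] := std_qlie. Qed.

Lemma qspr p (a : G p) : linear (qsp a : G p -> R^o).
Proof. by have [_ [+ _ _ _] _ _ _] := std_qlie; apply. Qed.

Lemma qspC p (a b : G p) : qsp a b = qsp b a.
Proof. by have [_ [_ + _ _] _ _ _] := std_qlie; apply. Qed.

Lemma qspl p (a : G p) : linear ((@qsp _ _ G p)^~ a : G p -> R^o).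
Proof. by move=> k u v; rewrite qspC (qspr a k u v) !(qspC a). Qed.

Lemma sR0r p v : sR D v (0 : T p) = 0.
Proof. by have [_ _ [/(_ p v) l _ _ _] _ _] := sd; exact: linear_zero l. Qed.

Lemma sR0l p v : sR D (0 : T p) v = 0.
Proof. by have [_ _ [_ /(_ p v) l _ _] _ _] := sd; exact: (linear_zero l). Qed.

Lemma sH0l p u v : sH D (0 : T p) u v = 0.
Proof. by have [_ _ _ [/(_ p u v) [_ _ l] _] _] := sd; exact: (linear_zero l). Qed.

Lemma sH0m p u v : sH D u (0 : T p) v = 0.
Proof. by have [_ _ _ [/(_ p u v) [_ l _] _] _] := sd; exact: (linear_zero l). Qed.

Lemma qsp0l p (a : G p) : qsp 0 a = 0. Proof. exact: (linear_zero (qspl a)). Qed.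
Lemma qsp0r p (a : G p) : qsp a 0 = 0. Proof. exact: (linear_zero (qspr a)). Qed.
Lemma qbr0l p (a : G p) : qbr 0 a = 0. Proof. exact: (linear_zero (qbrl a)). Qed.
Lemma qbr0r p (a : G p) : qbr a 0 = 0. Proof. exact: (linear_zero (qbrr a)). Qed.

Lemma qbr_anti p (a b : G p) : qbr a b = - qbr b a.
Proof.
have [_ _ alg _ _] := std_qlie.
have [ab _ _] := alg p (a + b) 0 0.
have [aa _ _] := alg p a 0 0; have [bb _ _] := alg p b 0 0.
move: ab; rewrite (linear_add (qbrl (a + b))) !(linear_add (qbrr _)).
by rewrite aa bb addr0 add0r => /eqP; rewrite addr_eq0 => /eqP.
Qed.

(** The curvature, connection and [H] terms are all fed a zero vector or a zero
section of [G], so only the Lie derivative survives. *)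
Lemma dorfman_form_right (u : section S) (eta : section C) p :
  smooth_section u ->
  dorfman u (fun q => ((0, eta q), 0) : S q) p =
    ((0, lie_form (fun q => (u q).1.1) eta p), 0).
Proof.
move=> /smooth_std [sX sxi sr].
rewrite /= /std_dorfman /= lie0r lie_form0l subr0 sR0r qbr0r.
rewrite (connection0 _ std_connection) (connection_tangent0 _ std_connection sr).
rewrite subr0 !addr0 (_ : (fun q => (u q).1.2 0) = fun=> 0); last first.
  by apply/funext => q; rewrite linear0.
rewrite dfun0 addr0 (_ : (fun _ => sH D _ _ _ - _ + _ + _) = fun=> 0) ?linfun0 ?addr0 //.
by apply/funext => z; rewrite sH0m sR0l qsp0l !qsp0r !mulr0 subr0 !addr0.
Qed.

Lemma dorfman_form_left (v : section S) (xi : section C) p :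
  smooth_section v ->
  dorfman (fun q => ((0, xi q), 0) : S q) v p =
    ((0, - lie_form (fun q => (v q).1.1) xi p
         + dfun (fun q => xi q (v q).1.1) p), 0).
Proof.
move=> /smooth_std [sX sxi sr].
rewrite /= /std_dorfman /= lie0l lie_form0l sub0r sR0l qbr0l.
rewrite (connection0 _ std_connection) (connection_tangent0 _ std_connection sr).
rewrite subr0 !addr0 (_ : (fun _ => sH D _ _ _ - _ + _ + _) = fun=> 0) ?linfun0 ?addr0 //.
apply/funext => z; rewrite sH0l sR0l (connection0 _ std_connection).
by rewrite !qsp0l !qsp0r !mulr0 subr0 !addr0.
Qed.

Lemma dorfman_vertical (xi eta : section C) (r s : section G) p :
  smooth_section r -> smooth_section s ->
  dorfman (fun q => ((0, xi q), r q) : S q) (fun q => ((0, eta q), s q) : S q) p =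
    ((0, linfun (fun z : T p => 2 * qsp (snabla z r) (s p) : R^o)), qbr (r p) (s p)).
Proof.
move=> sr ss; rewrite /= /std_dorfman /= lie0l !lie_form0l sR0l subr0 add0r.
rewrite !(connection_tangent0 _ std_connection) // subr0 !add0r.
rewrite (_ : (fun q => xi q 0) = fun=> 0); last first.
  by apply/funext => q; rewrite linear0.
rewrite dfun0 add0r; congr (_, linfun _, _); apply/funext => z.
by rewrite sH0l !sR0l !qsp0l !mulr0 subr0 addr0 add0r.
Qed.

End StandardData.

(** * The splitting defined by a non-degenerate structure *)

Section Nondegenerate.
Variables (R : realType) (M : manifold R) (D : std_data M).
Hypothesis sd : is_std_data D.
Notation G := (sG D).
Notation S := (standard D).
Notation T := (tangent M).
Notation C := (cotangent M).
Variable J : forall p, S p -> S p.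
Hypotheses (cS : courant_calculus S) (gJ : is_gcs J).

Definition covec p (xi : C p) : S p := ((0, xi), 0).

Definition bivector p (xi : C p) : T p := anchor (J (covec xi)).

Variable kappa : forall p, T p -> C p.
Hypotheses (kappaK : forall p (v : T p), bivector (kappa v) = - v)
           (bivectorK : forall p (xi : C p), kappa (bivector xi) = - xi).

(** The right inverse of the anchor with values in [J(T*M)]. *)
Definition splitting p (v : T p) : S p := - J (covec (kappa v)).

Definition splittingG p (v : T p) : G p := (splitting v).2.

(** The lift of [r] to the orthogonal complement of [J(T*M) + T*M]: its 1-form
part cancels the pairing of [r] with [J(T*M)]. *)
Definition ortho p (r : G p) : S p := ((0, kappa (anchor (J ((0, 0), r) : S p))), r).

(** The comparison map from the untwisted algebroid, whose summands are [TM],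
[T*M] and [G], to the given one. *)
Definition assemble p (x : S p) : S p := splitting x.1.1 + covec x.1.2 + ortho x.2.

Definition reduced p (r : G p) : G p := (J (ortho r)).2.

(** The [G]-component of the bracket of [splitting X] with a vertical section,
at [X p = v]. *)
Definition shifted_nabla p (v : T p) (s : section G) : G p :=
  snabla v s + qbr (splittingG v) (s p).

Let Jl p : linear (J (p := p)). Proof. by have [[]] := gJ. Qed.
Let JD p : {morph J (p := p) : u v / u + v}. Proof. exact: (linear_add (@Jl p)). Qed.
Let JN p : {morph J (p := p) : u / - u}. Proof. exact: (linear_opp (@Jl p)). Qed.
Let JJ p (u : S p) : J (J u) = - u. Proof. by have [_ _ ->] := gJ. Qed.
Let Jsk p (u v : S p) : csp (J u) v = - csp u (J v). Proof. by have [_ ->] := gJ. Qed.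

Let cspr p (u : S p) : linear (csp u : S p -> R^o).
Proof. by have [_ [+ _ _ _] _ _ _] := cS; apply. Qed.
Let cspC p (u v : S p) : csp u v = csp v u.
Proof. by have [_ [_ + _ _] _ _ _] := cS; apply. Qed.
Let cspDr p (u v w : S p) : csp u (v + w) = csp u v + csp u w.
Proof. exact: (linear_add (cspr u)). Qed.
Let cspNr p (u v : S p) : csp u (- v) = - csp u v.
Proof. exact: (linear_opp (cspr u)). Qed.
Let cspDl p (u v w : S p) : csp (v + w) u = csp v u + csp w u.
Proof. by rewrite cspC cspDr !(cspC u). Qed.
Let cspNl p (u v : S p) : csp (- v) u = - csp v u.
Proof. by rewrite cspC cspNr cspC. Qed.

Lemma csp_covec p (xi : C p) (x : S p) : csp (covec xi) x = 2^-1 * xi (anchor x).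
Proof. by rewrite /= linear0 add0r (qsp0l sd) addr0. Qed.

Lemma covecD p : {morph covec (p := p) : u v / u + v}.
Proof. by move=> u v; rewrite /form; congr (_, _, _); rewrite /= ?addr0. Qed.

Lemma covecN p : {morph covec (p := p) : u / - u}.
Proof. by move=> u; rewrite /form; congr (_, _, _); rewrite /= ?oppr0. Qed.

Lemma covec_linear p : linear (covec (p := p)).
Proof. by move=> a u v; rewrite /form; congr (_, _, _); rewrite /= ?scaler0 ?addr0. Qed.

Lemma covecP p (x : S p) : x.1.1 = 0 -> x.2 = 0 -> x = covec x.1.2.
Proof. by case: x => [[X xi] r] /= -> ->. Qed.

Lemma bivector_linear p : linear (bivector (p := p)).
Proof. by move=> a u v; rewrite /bivector covec_linear Jl. Qed.

Lemma kappa_linear p : linear (kappa (p := p)).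
Proof.
have can1 : cancel (fun xi : C p => - bivector xi) (fun v => kappa v).
  move=> xi; rewrite -(linear_opp (bivector_linear (p := p))) bivectorK opprK //.
apply: (linear_inverse _ can1).
  move=> a u v; rewrite bivector_linear opprD scalerN //.
by move=> v; rewrite kappaK opprK.
Qed.

Lemma splitting_linear p : linear (splitting (p := p)).
Proof. by move=> a u v; rewrite /splitting kappa_linear covec_linear Jl opprD scalerN. Qed.

Lemma splittingG_linear p : linear (splittingG (p := p)).
Proof. by move=> a u v; rewrite /splittingG splitting_linear. Qed.

Lemma ortho_linear p : linear (ortho (p := p)).
Proof.
move=> a u v; rewrite /ortho.
have -> : ((0, 0, a *: u + v) : S p) = a *: ((0, 0, u) : S p) + (0, 0, v).
  by congr (_, _, _); rewrite /= scaler0 addr0.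
by rewrite Jl kappa_linear; congr (_, _, _); rewrite /= scaler0 addr0.
Qed.

Lemma reduced_linear p : linear (reduced (p := p)).
Proof. by move=> a u v; rewrite /reduced ortho_linear Jl. Qed.

Lemma J_covec p (xi : C p) : J (covec xi) = splitting (bivector xi).
Proof. by rewrite /splitting bivectorK covecN JN opprK. Qed.

Lemma J_splitting p (v : T p) : J (splitting v) = covec (kappa v).
Proof. by rewrite /splitting JN JJ opprK. Qed.

Lemma anchor_splitting p (v : T p) : anchor (splitting v) = v.
Proof.
have -> : anchor (splitting v) = - bivector (kappa v) by [].
by rewrite kappaK opprK.
Qed.

Let two_gt0 : (2^-1 : R) != 0. Proof. by rewrite invr_neq0. Qed.

Lemma csp_covec_eq0 p (xi : C p) (x : S p) :
  csp (covec xi) x = 0 -> xi (anchor x) = 0.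
Proof.
by rewrite csp_covec => /eqP; rewrite mulf_eq0 (negbTE two_gt0) => /eqP.
Qed.

Lemma bivector_skew p (xi eta : C p) : xi (bivector eta) = - eta (bivector xi).
Proof.
apply: (mulfI two_gt0); rewrite mulrN -!csp_covec cspC; exact: Jsk.
Qed.

Lemma kappa_skew p (u v : T p) : kappa u v = - kappa v u.
Proof.
have := bivector_skew (kappa u) (kappa v); rewrite !kappaK !linearN opprK.
by move=> <-; rewrite opprK.
Qed.

Lemma kappa_alt p (u : T p) : kappa u u = 0.
Proof. by have := kappa_skew u u; lra. Qed.

Lemma csp_splitting_covec p (v : T p) (xi : C p) : csp (splitting v) (covec xi) = 2^-1 * xi v.
Proof. by rewrite cspC csp_covec anchor_splitting. Qed.

Lemma csp_splitting p (u v : T p) : csp (splitting u) (splitting v) = 0.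
Proof.
rewrite /splitting cspNl cspNr opprK Jsk JJ cspNr opprK csp_covec /=.
by rewrite linear0 mulr0.
Qed.

Lemma csp_ortho_splitting p (r : G p) (v : T p) : csp (ortho r) (splitting v) = 0.
Proof.
set a := anchor (J ((0, 0), r) : S p).
have -> : ortho r = covec (kappa a) + ((0, 0), r).
  by rewrite /ortho -/a; congr (_, _, _); rewrite /= ?addr0 ?add0r.
rewrite cspDl csp_covec anchor_splitting /splitting cspNr -Jsk cspC csp_covec -/a.
by rewrite -mulrDr kappa_skew addNr mulr0.
Qed.

Lemma kappa_ortho p (r : G p) (v : T p) : (ortho r).1.2 v = - 2 * qsp r (splittingG v).
Proof.
have : 2^-1 * ((splitting v).1.2 0 + (ortho r).1.2 (anchor (splitting v)))
    + qsp r (splittingG v) = 0.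
  exact: csp_ortho_splitting.
rewrite linear0 add0r anchor_splitting; lra.
Qed.

(** A vertical vector orthogonal to the image of [splitting] differs from the
lift of its [G]-component by a 1-form orthogonal to this image, which is zero.
*)
Lemma ortho_uniq p (x : S p) : anchor x = 0 ->
  (forall z, csp x (splitting z) = 0) -> x = ortho x.2.
Proof.
move=> x0 xs; apply/eqP; rewrite -subr_eq0; apply/eqP.
have e : x - ortho x.2 = covec (x - ortho x.2).1.2.
  have x0' : x.1.1 = 0 := x0.
  by apply: covecP; rewrite /= ?x0' subrr.
move: (x - ortho x.2).1.2 e => th e; rewrite e.
suff -> : th = 0 by [].
apply/lfunP => z; rewrite lfunE /= -(anchor_splitting z); apply: csp_covec_eq0.
by rewrite -e cspDl cspNl xs csp_ortho_splitting subr0.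
Qed.

(** The operator [J] is skew-symmetric and exchanges [T*M] and [J(T*M)], so it
preserves their common orthogonal complement. *)
Lemma J_ortho p (r : G p) : J (ortho r) = ortho (reduced r).
Proof.
apply: ortho_uniq => [|z]; last first.
  by rewrite Jsk J_splitting cspC csp_covec /= linear0 mulr0 oppr0.
have H (xi : C p) : xi (anchor (J (ortho r))) = 0.
  by apply: csp_covec_eq0; rewrite cspC Jsk J_covec csp_ortho_splitting oppr0.
have k0 : kappa (anchor (J (ortho r))) = 0.
  by apply/lfunP => z; rewrite lfunE /= kappa_skew H oppr0.
apply: oppr_inj; rewrite -kappaK k0 oppr0.
exact: linear_zero (@bivector_linear p).
Qed.

(** A vertical vector is [ortho r] plus a 1-form [th]; if its image under [J] is
vertical too, then [anchor (J th) = 0], so [th = 0]. *)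
Lemma reduced_vertical p (x : S p) : anchor x = 0 -> anchor (J x) = 0 ->
  (J x).2 = reduced x.2.
Proof.
move=> x0 Jx0.
have e : x - ortho x.2 = covec (x - ortho x.2).1.2.
  have x0' : x.1.1 = 0 := x0.
  by apply: covecP; rewrite /= ?x0' subrr.
move: (x - ortho x.2).1.2 e => th e.
have Jx : J x = ortho (reduced x.2) + splitting (bivector th).
  by rewrite -J_ortho -J_covec -JD -e addrC subrK.
have b0 : bivector th = 0.
  rewrite -(anchor_splitting (bivector th)) -Jx0 Jx /=.
  by rewrite add0r.
by rewrite Jx b0 (linear_zero (@splitting_linear p)) addr0.
Qed.

Lemma reducedK p (r : G p) : reduced (reduced r) = - r.
Proof. by rewrite {1}/reduced -J_ortho JJ. Qed.

Lemma csp_ortho p (r s : G p) : csp (ortho r) (ortho s) = qsp r s.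
Proof. by rewrite /= !linear0 addr0 mulr0 add0r. Qed.

Lemma reduced_skew p (r s : G p) : qsp (reduced r) s = - qsp r (reduced s).
Proof. by rewrite -!csp_ortho -!J_ortho Jsk. Qed.

(** * Involutivity of the splitting and the symplectic form *)

Let fT := @tangent_framed R M.
Let fC := @cotangent_framed R M.
Let fG := std_G_framed sd.
Let fS : framed S := std_framed sd.

Lemma enough_tangent : enough_sections T.
Proof.
have [[_ en] _ _ _ _] := cS; move=> p v; have [s [ss sp]] := en p ((v, 0), 0).
by exists (fun q => (s q).1.1); have /(smooth_std sd) [s1 _ _] := ss; rewrite sp.
Qed.

Lemma enough_cotangent : enough_sections C.
Proof.
have [[_ en] _ _ _ _] := cS; move=> p xi; have [s [ss sp]] := en p ((0, xi), 0).
by exists (fun q => (s q).1.2); have /(smooth_std sd) [_ s1 _] := ss; rewrite sp.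
Qed.

Lemma enough_G : enough_sections G.
Proof.
have [[_ en] _ _ _ _] := cS; move=> p r; have [s [ss sp]] := en p ((0, 0), r).
by exists (fun q => (s q).2); have /(smooth_std sd) [_ _ s1] := ss; rewrite sp.
Qed.

Let s0T := @smooth_section0 _ _ T.
Let s0C := @smooth_section0 _ _ C.
Let s0G := @smooth_section0 _ _ G.

Lemma smooth_covec (xi : section C) :
  smooth_section xi -> smooth_section (fun q => covec (xi q)).
Proof. by move=> sxi; exact: (smooth_std_pair sd s0T sxi s0G). Qed.

Lemma smooth_J (s : section S) :
  smooth_section s -> smooth_section (fun q => J (s q)).
Proof. by have [[_ Js] _ _ _] := gJ; exact: Js. Qed.

Lemma smooth_bivector (xi : section C) :
  smooth_section xi -> smooth_section (fun q => bivector (xi q) : T q).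
Proof. by move=> /smooth_covec /smooth_J /(smooth_std sd) []. Qed.

(** Up to sign, [kappa] is the fibrewise inverse of the smooth bundle map
[bivector]. *)
Lemma smooth_kappa (X : section T) :
  smooth_section X -> smooth_section (fun q => kappa (X q)).
Proof.
move=> sX; have H : smooth_section (fun q => - kappa (X q) : C q).
  apply: (@smooth_section_inv _ _ C T (fun p xi => bivector xi)
    (fun p v => - kappa v)) => //.
  - exact: enough_cotangent.
  - by move=> p; exact: bivector_linear.
  - by move=> p xi; rewrite bivectorK opprK.
  - by move=> p v; rewrite (linear_opp (@bivector_linear p)) kappaK opprK.
  - exact: smooth_bivector.
rewrite (_ : (fun _ => _) = fun q => - - kappa (X q)); last first.
  by apply: section_ext => q; rewrite opprK.
exact: (smooth_sectionN fC H).
Qed.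

Lemma smooth_splitting (X : section T) :
  smooth_section X -> smooth_section (fun q => splitting (X q)).
Proof.
by move=> /smooth_kappa /smooth_covec /smooth_J; exact: (smooth_sectionN fS).
Qed.

Lemma smooth_splittingG (X : section T) :
  smooth_section X -> smooth_section (fun q => splittingG (X q)).
Proof. by move=> /smooth_splitting /(smooth_std sd) []. Qed.

Lemma smooth_ortho (r : section G) :
  smooth_section r -> smooth_section (fun q => ortho (r q)).
Proof.
move=> sr; apply: (smooth_std_pair sd s0T) => //; apply: smooth_kappa.
have sS : smooth_section (fun q => ((0, 0), r q) : S q).
  exact: (smooth_std_pair sd s0T s0C sr).
by have /(smooth_std sd) [] := smooth_J sS.
Qed.

Lemma smooth_reduced (r : section G) :
  smooth_section r -> smooth_section (fun q => reduced (r q)).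
Proof. by move=> /smooth_ortho /smooth_J /(smooth_std sd) []. Qed.

Lemma anchor_dorfman (u v : section S) p :
  anchor (dorfman u v p) = lie (fun q => anchor (u q)) (fun q => anchor (v q)) p.
Proof. by []. Qed.

Lemma anchor_splitting_section (X : section T) : (fun q => anchor (splitting (X q))) = X.
Proof. by apply: section_ext => q; exact: anchor_splitting. Qed.

Lemma smooth_lie (X Y : vfield M) : smooth_section X -> smooth_section Y ->
  smooth_section (lie X Y).
Proof.
move=> sX sY; have [_ _ [_ ha] [hd _] _] := cS.
have := ha _ (hd _ _ (smooth_splitting sX) (smooth_splitting sY)).
suff <- : (fun p => anchor (dorfman (fun q => splitting (X q)) (fun q => splitting (Y q)) p))
    = lie X Y by [].
by apply: section_ext => p; rewrite anchor_dorfman !anchor_splitting_section.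
Qed.

Lemma dorfman_covec_covec (xi eta : section C) p :
  smooth_section xi ->
  dorfman (fun q => covec (xi q)) (fun q => covec (eta q)) p = 0.
Proof.
by move=> sxi; rewrite (dorfman_form_right sd _ _ (smooth_covec sxi)) lie_form0l.
Qed.

(** Apply the Nijenhuis identity to the 1-forms [kappa X] and [kappa Y]: the
bracket of [splitting X] and [splitting Y] is [J] of a 1-form, hence in the
image of [splitting], and its anchor is [lie X Y].  Reading off this 1-form
gives the second equation, which contains [dw = 0]. *)
Lemma dorfman_splitting_lie (X Y : vfield M) p : smooth_section X -> smooth_section Y ->
  dorfman (fun q => splitting (X q)) (fun q => splitting (Y q)) p = splitting (lie X Y p) /\
  dorfman (fun q => splitting (X q)) (fun q => covec (kappa (Y q))) p +
  dorfman (fun q => covec (kappa (X q))) (fun q => splitting (Y q)) p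
    = covec (kappa (lie X Y p)).
Proof.
move=> sX sY; have skX := smooth_kappa sX; have skY := smooth_kappa sY.
have sfX := smooth_covec skX; have sfY := smooth_covec skY.
have spX := smooth_splitting sX; have spY := smooth_splitting sY.
have Jf (Z : vfield M) : (fun q => J (covec (kappa (Z q)))) = (fun q => - splitting (Z q)).
  apply: section_ext => q; rewrite J_covec kappaK.
  by rewrite (linear_opp (@splitting_linear q)).
have := nijenhuis cS gJ p sfX sfY; rewrite !Jf dorfman_covec_covec // subr0.
have snX := smooth_sectionN fS spX; have snY := smooth_sectionN fS spY.
rewrite (dorfmanNl cS p spX snY) (dorfmanNr cS p spY spX).
rewrite (dorfmanNl cS p spX sfY) (dorfmanNr cS p spY sfX) opprK -opprD.
have [a ea] : exists a,
    dorfman (fun q => splitting (X q)) (fun q => covec (kappa (Y q))) p = covec a.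
  by rewrite (dorfman_form_right sd _ _ spX); eexists.
have [b eb] : exists b,
    dorfman (fun q => covec (kappa (X q))) (fun q => splitting (Y q)) p = covec b.
  by rewrite (dorfman_form_left sd _ _ spY); eexists.
rewrite ea eb -covecD -covecN J_covec => e.
have el : lie X Y p = bivector (- (a + b)).
  by rewrite -[RHS]anchor_splitting -e anchor_dorfman !anchor_splitting_section.
by rewrite e el; split=> //; rewrite bivectorK opprK.
Qed.

Lemma dorfman_splitting (X Y : vfield M) p : smooth_section X -> smooth_section Y ->
  dorfman (fun q => splitting (X q)) (fun q => splitting (Y q)) p = splitting (lie X Y p).
Proof. by move=> sX sY; have [] := dorfman_splitting_lie p sX sY. Qed.

Lemma vder_scale_half (X : vfield M) (f : M -> R) p : smooth_fun f ->
  vder (X p) (fun q => 2^-1 * f q) = 2^-1 * vder (X p) f.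
Proof.
move=> sf; rewrite /vder -deriveMl //; apply: diff_derivable.
have [+ _] := sf _ (@chart_at_atlas R M p) 1%N; apply.
by exists p => //; split=> //; exact: chart_at_dom.
Qed.

Lemma csp_smooth (u v : section S) : smooth_section u -> smooth_section v ->
  smooth_fun (fun q => csp (u q) (v q)).
Proof. by have [_ [_ _ _ h] _ _ _] := cS; exact: h. Qed.

Lemma kappa_form2 : is_form2 (fun p u v => kappa u v).
Proof.
split.
- by move=> p u a x y; rewrite linearP.
- by move=> p v a x y; rewrite kappa_linear !lfunE /= !lfunE.
- by move=> p u; exact: kappa_alt.
- move=> X Y sX sY.
  have := smooth_onM openT (@smooth_on_cst _ _ setT 2)
     (csp_smooth (smooth_covec (smooth_kappa sX)) (smooth_splitting sY)).
  apply: smooth_on_eq; first exact: openT.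
  by move=> p _; rewrite csp_covec anchor_splitting mulrA divff ?mul1r.
Qed.

Let smooth_kappa2 (X Y : vfield M) : smooth_section X -> smooth_section Y ->
  smooth_fun (fun q => kappa (X q) (Y q)).
Proof. by have [_ _ _] := kappa_form2; apply. Qed.

Let pairing (X Y : vfield M) :
  (fun q => csp (covec (kappa (X q))) (splitting (Y q))) =
  (fun q => 2^-1 * kappa (X q) (Y q)).
Proof. by apply/funext => q; rewrite csp_covec anchor_splitting. Qed.

(** This is the Cartan formula for the Lie derivative of [kappa Y], obtained
from invariance of the pairing instead of the definition of [lie_form]. *)
Let pairing_lie (X Y Z : vfield M) p :
  smooth_section X -> smooth_section Y -> smooth_section Z ->
  csp (dorfman (fun q => splitting (X q)) (fun q => covec (kappa (Y q))) p) (splitting (Z p))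
  = 2^-1 * (vder (X p) (fun q => kappa (Y q) (Z q)) - kappa (Y p) (lie X Z p)).
Proof.
move=> sX sY sZ.
have [_ _ _ _ ax] := cS.
have [_ e _] := ax _ _ _ (smooth_splitting sX) (smooth_covec (smooth_kappa sY))
  (smooth_splitting sZ) p.
apply: (addIr (csp (covec (kappa (Y p)))
  (dorfman (fun q => splitting (X q)) (fun q => splitting (Z q)) p))).
rewrite -e anchor_splitting pairing vder_scale_half; last exact: smooth_kappa2.
by rewrite dorfman_splitting // csp_covec anchor_splitting -mulrDr subrK.
Qed.

Let pairing_lie' (X Y Z : vfield M) p :
  smooth_section X -> smooth_section Y -> smooth_section Z ->
  csp (dorfman (fun q => covec (kappa (X q))) (fun q => splitting (Y q)) p) (splitting (Z p))
  = 2^-1 * (vder (Z p) (fun q => kappa (X q) (Y q))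
            - (vder (Y p) (fun q => kappa (X q) (Z q)) - kappa (X p) (lie Y Z p))).
Proof.
move=> sX sY sZ.
have [_ _ _ _ ax] := cS.
have [_ _ e] := ax _ _ _ (smooth_covec (smooth_kappa sX)) (smooth_splitting sY)
  (smooth_splitting sZ) p.
apply: (addIr (csp (dorfman (fun q => splitting (Y q)) (fun q => covec (kappa (X q))) p)
  (splitting (Z p)))).
rewrite -cspDl e anchor_splitting pairing vder_scale_half; last exact: smooth_kappa2.
by rewrite pairing_lie // -mulrDr subrK.
Qed.

(** Pair the second equation of [dorfman_splitting_lie] with [splitting Z]. *)
Lemma kappa_closed (X Y Z : vfield M) : smooth_section X -> smooth_section Y ->
  smooth_section Z -> forall p, d2 (fun p u v => kappa u v) X Y Z p = 0.
Proof.
move=> sX sY sZ p; have [_ sk] := dorfman_splitting_lie p sX sY.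
have alg (a b c d e f e' f' : R) : e = - e' -> f = - f' ->
    a - e' + (c - (b - f')) = d -> a - b + c - d + e - f = 0.
  by move=> -> -> <-; ring.
apply: alg (kappa_skew _ _) (kappa_skew _ _) _.
have := csp_covec (kappa (lie X Y p)) (splitting (Z p)).
by rewrite -sk cspDl pairing_lie // pairing_lie' // anchor_splitting -mulrDr => /(mulfI two_gt0).
Qed.

(** * The flat connection and the complex structure on the invariant complement *)

Lemma dorfman_snd (u v : section S) p :
  (dorfman u v p).2 =
    snabla (anchor (u p)) (fun q => (v q).2) - snabla (anchor (v p)) (fun q => (u q).2)
    + sR D (anchor (u p)) (anchor (v p)) + qbr (u p).2 (v p).2.
Proof. by []. Qed.

Let conn : is_connection (@snabla _ _ D) := std_connection sd.

(** Invariance of the pairing and [dorfman_splitting] show that the bracket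
stays orthogonal to the image of [splitting]; by [ortho_uniq] only its
[G]-component has to be computed. *)
Lemma dorfman_splitting_ortho (X : vfield M) (s : section G) p :
  smooth_section X -> smooth_section s ->
  dorfman (fun q => splitting (X q)) (fun q => ortho (s q)) p = ortho (shifted_nabla (X p) s).
Proof.
move=> sX ss; have spX := smooth_splitting sX; have sl := smooth_ortho ss.
have e2 : (dorfman (fun q => splitting (X q)) (fun q => ortho (s q)) p).2
    = shifted_nabla (X p) s.
  rewrite dorfman_snd anchor_splitting (_ : anchor (ortho (s p)) = 0) //.
  rewrite (connection_tangent0 _ conn (smooth_splittingG sX)) (sR0r sd) subr0 addr0.
  by [].
rewrite -e2; apply: ortho_uniq.
  by rewrite anchor_dorfman anchor_splitting_section lie0r.
move=> z; have [Z [sZ <-]] := enough_tangent z.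
have [_ _ _ _ ax] := cS.
have [_ e _] := ax _ _ _ spX sl (smooth_splitting sZ) p.
move: e; rewrite (_ : (fun q => csp (ortho (s q)) (splitting (Z q))) = fun=> 0); last first.
  by apply/funext => q; exact: csp_ortho_splitting.
by rewrite vder_cst dorfman_splitting // csp_ortho_splitting addr0 => <-.
Qed.

(** The two sections are orthogonal, so their bracket is antisymmetric. *)
Lemma dorfman_ortho_splitting (Y : vfield M) (r : section G) p :
  smooth_section Y -> smooth_section r ->
  dorfman (fun q => ortho (r q)) (fun q => splitting (Y q)) p = - ortho (shifted_nabla (Y p) r).
Proof.
move=> sY sr; have spY := smooth_splitting sY; have sl := smooth_ortho sr.
apply/eqP; rewrite -addr_eq0 -dorfman_splitting_ortho //; apply/eqP.
have [[_ en] [_ _ nondeg _] _ _ ax] := cS.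
apply: nondeg => z; have [w [sw <-]] := en p z.
have [_ _ ->] := ax _ _ _ sl spY sw p.
rewrite (_ : (fun q => _) = fun=> 0) ?vder_cst //.
by apply/funext => q; exact: csp_ortho_splitting.
Qed.

Lemma shifted_nabla_add p v (s t : section G) : smooth_section s -> smooth_section t ->
  shifted_nabla v (fun q => s q + t q) = shifted_nabla v s + shifted_nabla v t :> G p.
Proof.
move=> ss st; have [_ add _ _] := conn.
by rewrite /shifted_nabla add // (linear_add (@qbrr _ _ _ sd _ _)) addrACA.
Qed.

Lemma shifted_nabla_connection : is_connection (fun p v s => shifted_nabla v s : G p).
Proof.
have [lin add leib sm] := conn.
split.
- move=> p s ss a u v; rewrite /shifted_nabla (lin p s ss) splittingG_linear (qbrl sd).
  by rewrite scalerDr addrACA.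
- by move=> p v s t ss st; exact: shifted_nabla_add.
- move=> p v f s sf ss; rewrite /shifted_nabla (leib p v f s sf ss).
  have -> : qbr (splittingG v) (f p *: s p) = f p *: qbr (splittingG v) (s p).
    by rewrite -[_ *: s p]addr0 (qbrr sd) (qbr0r sd) addr0.
  by rewrite scalerDr addrA.
- move=> X s sX ss; apply: (smooth_sectionD fG); first exact: sm.
  have [_ _ _ _ sq] := std_qlie sd; apply: sq => //; exact: smooth_splittingG.
Qed.

Lemma shifted_nabla_smooth (X : vfield M) (s : section G) :
  smooth_section X -> smooth_section s ->
  smooth_section (fun p => shifted_nabla (X p) s).
Proof. by have [_ _ _ sm] := shifted_nabla_connection; exact: sm. Qed.

(** The Jacobi identity for [splitting X], [splitting Y] and [ortho s]. *)
Lemma shifted_nabla_flat (X Y : vfield M) (s : section G) :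
  smooth_section X -> smooth_section Y -> smooth_section s -> forall p,
  curvature (fun p v s => shifted_nabla v s : G p) X Y s p = 0.
Proof.
move=> sX sY ss p; have [_ _ _ _ ax] := cS.
have [jac _ _] := ax _ _ _ (smooth_splitting sX) (smooth_splitting sY) (smooth_ortho ss) p.
have e (U : vfield M) (r : section G) : smooth_section U -> smooth_section r ->
    dorfman (fun q => splitting (U q)) (fun q => ortho (r q))
    = (fun q => ortho (shifted_nabla (U q) r)).
  by move=> sU sr; apply: section_ext => q; exact: dorfman_splitting_ortho.
have e' : dorfman (fun q => splitting (X q)) (fun q => splitting (Y q))
    = (fun q => splitting (lie X Y q)).
  by apply: section_ext => q; exact: dorfman_splitting.
have sYs := shifted_nabla_smooth sY ss; have sXs := shifted_nabla_smooth sX ss.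
move: jac; rewrite e' !e //; last exact: smooth_lie.
move=> /(congr1 snd) /= jac.
by rewrite /curvature jac addrK subrr.
Qed.

(** The operator [ad (splittingG v)] is a derivation by the Jacobi identity of
[G]. *)
Lemma shifted_nabla_qbr p v (s t : section G) : smooth_section s -> smooth_section t ->
  shifted_nabla v (fun q => qbr (s q) (t q))
    = qbr (shifted_nabla v s) (t p) + qbr (s p) (shifted_nabla v t).
Proof.
move=> ss st; have [_ _ _ _ [der _ _ _ _]] := sd.
rewrite /shifted_nabla der // (linear_add (@qbrl _ _ _ sd _ _)) (linear_add (@qbrr _ _ _ sd _ _)).
rewrite -!addrA; congr (_ + _); rewrite addrCA; congr (_ + _).
have [_ _ alg _ _] := std_qlie sd.
have [_ + _] := alg p (splittingG v) (s p) (t p).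
rewrite (qbr_anti sd (t p) (splittingG v)) (linear_opp (@qbrr _ _ _ sd _ (s p))).
rewrite (qbr_anti sd (t p) (qbr (splittingG v) (s p))) -addrA -opprD => /eqP.
by rewrite addr_eq0 opprK addrC => /eqP.
Qed.

Lemma shifted_nabla_qsp p v (s t : section G) : smooth_section s -> smooth_section t ->
  vder v (fun q => qsp (s q) (t q))
    = qsp (shifted_nabla v s : G p) (t p) + qsp (s p) (shifted_nabla v t).
Proof.
move=> ss st; have [_ _ _ _ [_ met _ _ _]] := sd.
have [_ _ alg _ _] := std_qlie sd; have [_ _ inv] := alg p (splittingG v) (s p) (t p).
rewrite met // /shifted_nabla (linear_add (qspr sd (s p))) (linear_add (@qspl _ _ _ sd _ (t p))).
by rewrite addrACA inv addr0.
Qed.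

Lemma shifted_nabla_untwisted : is_std_data (untwisted (fun p v s => shifted_nabla v s : G p)).
Proof.
have [ncl nadd nleib nsm] := shifted_nabla_connection.
split.
- exact: (std_qlie sd).
- exact: shifted_nabla_connection.
- split=> //=; first by move=> p u a x y; rewrite scaler0 addr0.
  by move=> p v a x y; rewrite scaler0 addr0.
- rewrite /is_form3; split; [|split] => /=.
  + by move=> p u v; split=> a x y; rewrite scaler0 addr0.
  + by [].
  + by move=> X Y Z _ _ _; exact: smooth_on_cst.
- split=> /=.
  + by move=> p v s t ss st; exact: shifted_nabla_qbr.
  + by move=> p v s t ss st; exact: shifted_nabla_qsp.
  + by move=> X Y s sX sY ss p; rewrite shifted_nabla_flat // (qbr0l sd).
  + move=> X Y Z sX sY sZ p; rewrite /dnabla2.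
    by rewrite !(connection0 _ shifted_nabla_connection) !subr0 !addr0.
  + move=> X Y Z V _ _ _ _ p; rewrite /d3 !vder_cst (qsp0l sd).
    by rewrite !(subr0, addr0, mulr0).
Qed.

Lemma dorfman_covec_vertical (xi : section C) (x : section S) p :
  smooth_section x -> (forall q, anchor (x q) = 0) ->
  dorfman (fun q => covec (xi q)) x p = 0.
Proof.
move=> sx x0; rewrite (dorfman_form_left sd _ _ sx).
have -> : (fun q => (x q).1.1) = (fun=> 0) by apply: section_ext => q; exact: x0.
rewrite lie_form0l oppr0 add0r.
have -> : (fun q => xi q (x q).1.1) = (fun=> 0).
  by apply/funext => q; have -> : (x q).1.1 = 0 := x0 q; rewrite linear0.
by rewrite dfun0.
Qed.

(** The Nijenhuis identity for the 1-form [kappa X] and [ortho s], where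
brackets of 1-forms with vertical sections vanish. *)
Lemma shifted_nabla_reduced p v (s : section G) : smooth_section s ->
  shifted_nabla v (fun q => reduced (s q)) = reduced (shifted_nabla v s : G p).
Proof.
move=> ss; have [X [sX <-]] := enough_tangent v.
have sl := smooth_ortho ss; have sr := smooth_reduced ss; have slr := smooth_ortho sr.
have skX := smooth_kappa sX; have spX := smooth_splitting sX.
have Jf : (fun q => J (covec (kappa (X q)))) = (fun q => - splitting (X q)).
  by apply: section_ext => q; rewrite J_covec kappaK (linear_opp (@splitting_linear q)).
have Jlift : (fun q => J (ortho (s q))) = (fun q => ortho (reduced (s q))).
  by apply: section_ext => q; rewrite J_ortho.
have := nijenhuis cS gJ p (smooth_covec skX) sl; rewrite Jf Jlift.
rewrite (dorfmanNl cS p spX sl) (dorfmanNl cS p spX slr).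
rewrite !dorfman_covec_vertical // !dorfman_splitting_ortho // subr0 addr0.
by rewrite JN J_ortho => /oppr_inj /(congr1 snd).
Qed.

(** The [G]-component of the Nijenhuis identity for [ortho s] and [ortho s'],
where [s] and [s'] extend [a] and [a'].  Both sides have anchor 0, so
[reduced_vertical] applies on the right. *)
Lemma reduced_integrable p (a b a' b' : G p) :
  in_i_eigenspace (@reduced p) a b -> in_i_eigenspace (@reduced p) a' b' ->
  in_i_eigenspace (@reduced p) (qbr a a' - qbr b b') (qbr a b' + qbr b a').
Proof.
move=> [ab _] [ab' _].
have [s [ss sp]] := enough_G a; have [s' [ss' sp']] := enough_G a'.
have sl := smooth_ortho ss; have sl' := smooth_ortho ss'.
have sr := smooth_reduced ss; have sr' := smooth_reduced ss'.
have Jlift (r : section G) : (fun q => J (ortho (r q))) = (fun q => ortho (reduced (r q))).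
  by apply: section_ext => q; rewrite J_ortho.
have vert (r t : section G) : smooth_section r -> smooth_section t ->
    anchor (dorfman (fun q => ortho (r q)) (fun q => ortho (t q)) p) = 0 /\
    (dorfman (fun q => ortho (r q)) (fun q => ortho (t q)) p).2 = qbr (r p) (t p).
  by move=> sr1 st1; rewrite (dorfman_vertical sd _ _ p sr1 st1).
have := nijenhuis cS gJ p sl sl'; rewrite !Jlift => N.
have [a1 b1] := vert _ _ sr sr'; have [a2 b2] := vert _ _ ss ss'.
have [a3 b3] := vert _ _ sr ss'; have [a4 b4] := vert _ _ ss sr'.
have key : qbr (reduced a) (reduced a') - qbr a a' =
    reduced (qbr (reduced a) a' + qbr a (reduced a')).
  have := congr1 snd N; rewrite reduced_vertical.
  - have sndB (x y : S p) : (x - y).2 = x.2 - y.2 by [].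
    have sndD (x y : S p) : (x + y).2 = x.2 + y.2 by [].
    by rewrite sndB sndD b1 b2 b3 b4 sp sp'.
  - have anD (x y : S p) : anchor (x + y) = anchor x + anchor y by [].
    by rewrite anD a3 a4 addr0.
  - have anB (x y : S p) : anchor (x - y) = anchor x - anchor y by [].
    by rewrite -N anB a1 a2 subr0.
have Eb : b = - reduced a by rewrite ab opprK.
have Eb' : b' = - reduced a' by rewrite ab' opprK.
rewrite Eb Eb' (linear_opp (@qbrl _ _ _ sd _ _)) !(linear_opp (@qbrr _ _ _ sd _ _)).
rewrite (linear_opp (@qbrl _ _ _ sd _ _)) opprK.
have e1 : - qbr a (reduced a') - qbr (reduced a) a' =
   - (qbr (reduced a) a' + qbr a (reduced a')) by rewrite opprD addrC.
have e2 : qbr a a' - qbr (reduced a) (reduced a') =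
   - reduced (qbr (reduced a) a' + qbr a (reduced a')) by rewrite -key opprB.
rewrite e1 e2; split.
  by rewrite (linear_opp (@reduced_linear p)) reducedK opprK.
by rewrite (linear_opp (@reduced_linear p)).
Qed.

Lemma assemble_linear p : linear (assemble (p := p)).
Proof.
have alg (V : zmodType) (x1 x2 x3 x4 x5 x6 : V) :
    x1 + x2 + (x3 + x4) + (x5 + x6) = x1 + x3 + x5 + (x2 + x4 + x6).
  by rewrite (addrACA x1) (addrACA (x1 + x3)).
move=> a u v; rewrite /assemble splitting_linear covec_linear ortho_linear !scalerDr.
exact: alg.
Qed.

Let anchor_assemble p (x : S p) : anchor (assemble x) = anchor x.
Proof.
have anD (y z : S p) : anchor (y + z) = anchor y + anchor z by [].
rewrite /assemble !anD anchor_splitting.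
by rewrite (_ : anchor (covec _) = 0) // (_ : anchor (ortho _) = 0) // !addr0.
Qed.

Definition disassemble p (y : S p) : S p :=
  let z := y - splitting y.1.1 in ((y.1.1, (z - ortho z.2).1.2), z.2).

Let assembleE p (X : T p) (xi : C p) (r : G p) :
  assemble ((X, xi), r) = splitting X + covec xi + ortho r.
Proof. by []. Qed.

Lemma assembleK p : cancel (@assemble p) (@disassemble p).
Proof.
move=> x; rewrite /disassemble.
have -> : (assemble x).1.1 = x.1.1 := anchor_assemble x.
have -> : assemble x - splitting x.1.1 = covec x.1.2 + ortho x.2.
  have alg (V : zmodType) (a b c : V) : a + b + c - a = b + c.
    by rewrite -(addrA a) (addrC a) addrK.
  exact: alg.
have -> : (covec x.1.2 + ortho x.2).2 = x.2 by rewrite /= add0r.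
by rewrite addrK; case: x => [[]].
Qed.

Lemma disassembleK p : cancel (@disassemble p) (@assemble p).
Proof.
move=> y; pose z := y - splitting y.1.1.
have z0 : anchor z = 0.
  have anB (u v : S p) : anchor (u - v) = anchor u - anchor v by [].
  by rewrite /z anB anchor_splitting subrr.
have f : covec (z - ortho z.2).1.2 = z - ortho z.2.
  symmetry; apply: covecP; last by rewrite /= subrr.
  have anB (u v : S p) : (u - v).1.1 = anchor u - anchor v by [].
  by rewrite anB z0 (_ : anchor (ortho _) = 0) // subr0.
rewrite /disassemble -/z assembleE f.
by rewrite -addrA subrK addrC /z subrK.
Qed.

Let disassemble_smooth (t : section S) :
  smooth_section t -> smooth_section (fun q => disassemble (t q)).
Proof.
move=> st; have [sX _ _] := (smooth_std sd t).1 st.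
have sz : smooth_section (fun q => t q - splitting (t q).1.1 : S q).
  by apply: (smooth_sectionB fS) => //; exact: smooth_splitting.
have [_ _ sz2] := (smooth_std sd _).1 sz.
have sw := smooth_sectionB fS sz (smooth_ortho sz2).
have [_ sw1 _] := (smooth_std sd _).1 sw.
exact: (smooth_std_pair sd sX sw1 sz2).
Qed.

Lemma assemble_smooth (s : section S) :
  smooth_section s <-> smooth_section (fun q => assemble (s q)).
Proof.
split=> [/(smooth_std sd) [sX sxi sr]|/disassemble_smooth su].
  apply: (smooth_sectionD fS); last exact: smooth_ortho.
  by apply: (smooth_sectionD fS); [exact: smooth_splitting | exact: smooth_covec].
suff <- : (fun q => disassemble (assemble (s q))) = s by [].
by apply: section_ext => q; rewrite assembleK.
Qed.

Lemma csp_assemble p (x y : S p) : csp (assemble x) (assemble y) = csp x y.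
Proof.
rewrite /assemble !cspDl !cspDr csp_splitting csp_splitting_covec (cspC (splitting _) (ortho _)).
rewrite !csp_ortho_splitting !csp_covec csp_ortho (cspC (ortho _) (covec _)) csp_covec.
rewrite (_ : anchor (covec _) = 0) // (_ : anchor (ortho _) = 0) // anchor_splitting.
by rewrite !linear0 !mulr0 !addr0 !add0r -mulrDr.
Qed.

Let w p (u v : T p) : R := kappa u v.

Lemma flat_kappa p (u : T p) : flat w p u = kappa u.
Proof.
have e (x : T p) : linfun (fun v => w x v : R^o) = kappa x.
  apply/lfunP => v; rewrite linfun_linear // => a y z; exact: linearP.
rewrite /flat linfun_linear ?e // => a x y; rewrite !e; exact: kappa_linear.
Qed.

Lemma flat_inv p (xi : C p) : (flat w p)^-1%VF xi = - bivector xi.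
Proof.
have k : lker (flat w p) == 0%VS.
  apply/lker0P => x y; rewrite !flat_kappa => e.
  by apply: oppr_inj; rewrite -!kappaK e.
have e : flat w p (- bivector xi) = xi.
  by rewrite flat_kappa (linear_opp (@kappa_linear p)) bivectorK opprK.
transitivity ((flat w p)^-1%VF (flat w p (- bivector xi))); first by rewrite e.
exact: lker0_lfunK.
Qed.

Lemma assemble_J_can p (x : S p) :
  assemble (@J_can R M G (fun p v s => shifted_nabla v s) w reduced p x) = J (assemble x).
Proof.
rewrite /assemble !JD J_splitting J_covec J_ortho /J_can.
transitivity (splitting (- (flat w p)^-1%VF x.1.2)
  + covec (flat w p x.1.1) + ortho (reduced x.2)).
  by [].
by rewrite flat_kappa flat_inv opprK (addrC (splitting _)).
Qed.

Let covec_ortho p (xi : C p) (r : G p) :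
  covec xi + ortho r = ((0, xi + (ortho r).1.2), r).
Proof.
have pairE (a a' : T p) (b b' : C p) (c c' : G p) :
  ((a, b), c) + ((a', b'), c') = ((a + a', b + b'), c + c') :> S p by [].
by rewrite pairE !add0r.
Qed.

(** The bracket of two lifts is the lift of their bracket plus a 1-form.
Passing from [nabla] to [shifted_nabla] in this 1-form accounts for the 1-form
part of [ortho [r, s]], by invariance of the pairing. *)
Let vertical_covec_ortho p (r s : section G) : smooth_section r ->
  ((0, linfun (fun z : T p => 2 * qsp (snabla z r) (s p) : R^o)), qbr (r p) (s p)) =
  covec (linfun (fun z : T p => 2 * qsp (shifted_nabla z r : G p) (s p) : R^o))
    + ortho (qbr (r p) (s p)).
Proof.
move=> sr; rewrite covec_ortho; congr (_, _, _); apply/lfunP => z.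
have lin (D' : forall p, T p -> section G -> G p) : is_connection D' ->
    linear (fun z : T p => 2 * qsp (D' p z r) (s p) : R^o).
  move=> [cl _ _ _] a x y; rewrite (cl p r sr) (qspl sd) mulrDr.
  by congr (_ + _); rewrite [LHS]mulrCA.
rewrite add_lfunE !linfun_linear; try exact: lin shifted_nabla_connection; try exact: lin conn.
rewrite kappa_ortho /shifted_nabla (linear_add (@qspl _ _ _ sd _ (s p))).
have [_ _ alg _ _] := std_qlie sd.
have [_ _ inv] := alg p (r p) (splittingG z) (s p).
rewrite (qbr_anti sd (splittingG z)) (linear_opp (@qspl _ _ _ sd _ (s p))).
move: inv; rewrite (qspC sd (splittingG z)); move: (qsp _ _) (qsp _ _) (qsp _ _) => a b c.
lra.
Qed.

(** The bracket on the left is biadditive, so it is determined by its values on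
the three summands. *)
Lemma dorfman_assemble (u v : section S) p : smooth_section u -> smooth_section v ->
  dorfman (fun q => assemble (u q)) (fun q => assemble (v q)) p =
  assemble (std_dorfman (D := untwisted (fun p v s => shifted_nabla v s : G p)) u v p).
Proof.
move=> su sv.
have [sX sxi sr] := (smooth_std sd u).1 su; have [sY seta ss] := (smooth_std sd v).1 sv.
set X := (fun q => (u q).1.1) in sX; set xi := (fun q => (u q).1.2) in sxi.
set r := (fun q => (u q).2) in sr; set Y := (fun q => (v q).1.1) in sY.
set eta := (fun q => (v q).1.2) in seta; set s := (fun q => (v q).2) in ss.
have spX := smooth_splitting sX; have spY := smooth_splitting sY.
have fx := smooth_covec sxi; have fe := smooth_covec seta.
have lr := smooth_ortho sr; have ls := smooth_ortho ss.
have vx := smooth_sectionD fS fx lr; have ve := smooth_sectionD fS fe ls.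
have splitting3 (t : section S) : (fun q => assemble (t q)) =
    (fun q => splitting (t q).1.1 + (covec (t q).1.2 + ortho (t q).2)).
  by apply: section_ext => q; rewrite addrA.
rewrite !splitting3 (dorfmanDl cS p spX vx (smooth_sectionD fS spY ve)).
rewrite (dorfmanDr cS p spY ve spX) (dorfmanDr cS p spY ve vx).
rewrite (dorfmanDr cS p fe ls spX) (dorfmanDl cS p fx lr spY).
have fl (z : section C) (t : section G) : (fun q => covec (z q) + ortho (t q)) =
    (fun q => ((0, z q + (ortho (t q)).1.2), t q)).
  by apply: section_ext => q; exact: covec_ortho.
have vert : dorfman (fun q => covec (xi q) + ortho (r q))
      (fun q => covec (eta q) + ortho (s q)) p
    = covec (linfun (fun z : T p => 2 * qsp (shifted_nabla z r : G p) (s p) : R^o))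
      + ortho (qbr (r p) (s p)).
  by rewrite !fl (dorfman_vertical sd _ _ p sr ss) vertical_covec_ortho.
have right : dorfman (fun q => splitting (X q)) (fun q => covec (eta q)) p
    = covec (lie_form X eta p).
  by rewrite (dorfman_form_right sd eta p spX) -[in RHS](anchor_splitting_section X).
have left : dorfman (fun q => covec (xi q)) (fun q => splitting (Y q)) p
    = covec (- lie_form Y xi p + dfun (fun q => xi q (Y q)) p).
  by rewrite (dorfman_form_left sd xi p spY) -[in RHS](anchor_splitting_section Y).
rewrite vert right left dorfman_splitting //.
rewrite dorfman_splitting_ortho // dorfman_ortho_splitting //.
have -> : std_dorfman (D := untwisted (fun p v s => shifted_nabla v s : G p)) u v p =
  ((lie X Y p, lie_form X eta p + (- lie_form Y xi p + dfun (fun q => xi q (Y q)) p)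
     + linfun (fun z : T p => 2 * qsp (shifted_nabla z r : G p) (s p) : R^o)),
   shifted_nabla (X p) s - shifted_nabla (Y p) r + qbr (r p) (s p)).
  rewrite /std_dorfman /= addrA addr0.
  congr (_, _ + linfun _, _); apply/funext => z.
  by rewrite !(qsp0l sd) mulr0 subr0 !add0r.
have liftE (a b c : G p) : ortho (a - b + c) = ortho a - ortho b + ortho c.
  by rewrite !(linear_add (@ortho_linear p)) (linear_opp (@ortho_linear p)).
rewrite assembleE liftE 2!covecD.
have alg (V : zmodType) (a b c d e f g : V) :
    a + (b + c) + (d - e + (f + g)) = a + (b + d + f) + (c - e + g).
  rewrite -!addrA; congr (_ + (_ + _)); rewrite (addrCA c d); congr (_ + _).
  by rewrite (addrCA f c) (addrCA f (- e)).
exact: alg.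
Qed.

Lemma assemble_iso :
  @is_isomorphism R M (standard (untwisted (fun p v s => shifted_nabla v s : G p))) S
    (fun p x => assemble x).
Proof.
apply/isomorphismP; split.
- by move=> p; exact: assemble_linear.
- by move=> p; exists (@disassemble p); [exact: assembleK | exact: disassembleK].
- exact: assemble_smooth.
- move=> p x; split; first exact: anchor_assemble.
  by move=> y; exact: csp_assemble.
- by move=> u v su sv p; exact: dorfman_assemble.
Qed.

Lemma reduced_canonical : is_canonical (fun p v s => shifted_nabla v s : G p) w reduced.
Proof.
split.
- exact: shifted_nabla_untwisted.
- split; first exact: kappa_form2.
    move=> p u u0; apply: oppr_inj; rewrite -kappaK oppr0.
    have -> : kappa u = 0 by apply/lfunP => v; rewrite lfunE; exact: u0.
    exact: linear_zero (@bivector_linear p).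
  exact: kappa_closed.
- split; first by split; [move=> p; exact: reduced_linear | exact: smooth_reduced].
  exact: reduced_skew.
- by move=> p v s ss; exact: shifted_nabla_reduced.
- split; first by move=> p a; exact: reducedK.
  by move=> p a b a' b'; exact: reduced_integrable.
Qed.

End Nondegenerate.

(** * The canonical form and the uniqueness of its symplectic form *)

Section CanonicalForm.
Variables (R : realType) (M : manifold R).

Lemma nondegenerate_isomorphic_canonical (E : courant M) (J : forall p, E p -> E p) :
  is_courant E -> is_gcs J -> gcs_nondegenerate J ->
  exists (G : qlie M) (nabla : forall p, tangent M p -> section G -> G p)
         (w : forall p, tangent M p -> tangent M p -> R)
         (A : forall p, G p -> G p),
    is_canonical nabla w A /\ gcs_isomorphic J (@J_can R M G nabla w A).
Proof.
move=> cE gJ [D [J' [sd iso nd]]].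
have [I [isoI JI]] := iso.
have cS := courant_calculus_iso (std_framed sd) isoI (courant_courant_calculus cE).
have gJ' := is_gcs_iso isoI JI gJ.
have [K [PK KP]] := fibrewise_inverse nd.
(* The sign makes [J (splitting v) = flat w v], as in the definition of [J_w]. *)
pose kappa p (v : tangent M p) := K p (- v).
have Pl p : linear (@bivector R M D J' p) by exact: bivector_linear.
have kappaK p (v : tangent M p) : bivector J' (kappa p v) = - v by exact: KP.
have bivK p (xi : cotangent M p) : kappa p (bivector J' xi) = - xi.
  rewrite /kappa -(linear_opp (Pl p)); exact: PK.
exists (sG D), (fun p v s => shifted_nabla J' kappa v s),
  (fun p u v => kappa p u v), (reduced J' kappa).
split; first exact: (reduced_canonical sd cS gJ' kappaK bivK).
apply: gcs_isomorphic_trans iso _; apply: gcs_isomorphic_sym.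
exists (fun p x => assemble J' kappa x).
split; first exact: (assemble_iso sd cS gJ' kappaK bivK).
by move=> p u; exact: (assemble_J_can sd cS gJ' kappaK bivK).
Qed.

Lemma flatE (w : forall p, tangent M p -> tangent M p -> R) p (u v : tangent M p) :
  is_form2 w -> flat w p u v = w p u v.
Proof.
move=> [wr wl _ _].
have e (x : tangent M p) y : linfun (fun v => w p x v : R^o) y = w p x y.
  by rewrite linfun_linear //; exact: wr.
rewrite /flat linfun_linear ?e // => a x y; apply/lfunP => z.
by rewrite !lfunE /= !lfunE /= !e; exact: wl.
Qed.

(** The map [K] is surjective on each fibre, so [dmap phi] is onto and hence
injective, and [K] maps vertical vectors onto vertical vectors.  So the image
[x] of the 1-form [flat w u] is orthogonal to all vertical vectors, that is, a
1-form.  Compatibility with [J] identifies it as [flat w' (dmap phi u)], and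
pairing with the image of [v] compares [w] and [w']. *)
Lemma canonical_symplectic_unique (G G' : qlie M)
    (nabla : forall p, tangent M p -> section G -> G p)
    (nabla' : forall p, tangent M p -> section G' -> G' p)
    (w w' : forall p, tangent M p -> tangent M p -> R)
    (A : forall p, G p -> G p) (A' : forall p, G' p -> G' p)
    (phi : M -> M)
    (K : forall p, standard (untwisted nabla) p -> standard (untwisted nabla') (phi p)) :
  is_canonical nabla w A -> is_canonical nabla' w' A' ->
  (forall p, bijective (K p)) ->
  (forall p u, anchor (K p u) = dmap phi (anchor u)) ->
  (forall p u v, csp (K p u) (K p v) = csp u v) ->
  (forall p u, K p (@J_can R M G nabla w A p u) = @J_can R M G' nabla' w' A' (phi p) (K p u)) ->
  forall p u v, w' (phi p) (dmap phi u) (dmap phi v) = w p u v.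
Proof.
move=> [sd [fw _ _] [[Al _] _] _ _] [sd' [fw' _ _] _ _ _] bK aK cK JK p u v.
have [L KL LK] := bK p.
pose xi := flat w p u.
pose x := K p ((0, xi), 0).
have dinj (a : tangent M p) : dmap phi a = 0 -> a = 0.
  have dsurj i : exists a : tangent M p, dmap phi a = delta_mx 0 i.
    exists (anchor (L ((delta_mx 0 i, 0), 0))).
    by rewrite -aK LK.
  have [U HU] := choice dsurj; rewrite /dmap in HU *; move: (jacobian _ _) HU => B HU.
  have UB : (\matrix_i U i) *m B = 1%:M.
    by apply/row_matrixP => i; rewrite row_mul rowK HU rowE mulmx1.
  by move=> aB; rewrite -[a]mulmx1 -(mulmx1C UB) mulmxA aB mul0mx.
have x2 : x.2 = 0.
  have [_ [_ _ nondeg _] _ _ _] := std_qlie sd'.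
  apply: nondeg => s.
  have -> : qsp x.2 s = csp x (((0, 0), s) : standard (untwisted nabla') (phi p)).
    by rewrite /= !linear0 lfunE /= addr0 mulr0 add0r.
  rewrite -[X in csp x X]LK cK /= (qsp0l sd) linear0 add0r addr0.
  rewrite (_ : (L ((0, 0), s)).1.1 = 0) ?linear0 ?mulr0 //.
  by apply: dinj; have := aK p (L ((0, 0), s)); rewrite LK => <-.
have x11 : x.1.1 = 0 by rewrite -[LHS]/(anchor x) aK /dmap mul0mx.
have x12 : x.1.2 = flat w' (phi p) (dmap phi u).
  have -> : x = @J_can R M G' nabla' w' A' (phi p) (K p ((u, 0), 0)).
    by rewrite -JK /J_can /= (linear_zero (Al p)) linear0 oppr0.
  rewrite /J_can /=; congr (flat w' _ _); exact: (aK p ((u, 0), 0)).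
have := cK p ((0, xi), 0) ((v, 0), 0); rewrite -/x /=.
have -> : (K p (v, 0, 0)).1.1 = dmap phi v := aK p ((v, 0), 0).
rewrite x11 x2 x12 !linear0 !add0r (qsp0l sd) (qsp0l sd') !addr0.
rewrite !flatE // => /mulfI; apply.
by rewrite invr_neq0.
Qed.

Lemma canonical_equivalent_symplectic (E E' : courant M)
    (J : forall p, E p -> E p) (J' : forall p, E' p -> E' p) (G G' : qlie M)
    (nabla : forall p, tangent M p -> section G -> G p)
    (nabla' : forall p, tangent M p -> section G' -> G' p)
    (w w' : forall p, tangent M p -> tangent M p -> R)
    (A : forall p, G p -> G p) (A' : forall p, G' p -> G' p)
    (phi : M -> M) (I : forall p, E p -> E' (phi p)) :
  is_canonical nabla w A -> gcs_isomorphic J (@J_can R M G nabla w A) ->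
  is_canonical nabla' w' A' -> gcs_isomorphic J' (@J_can R M G' nabla' w' A') ->
  is_equivalence I -> (forall p u, I p (J p u) = J' (phi p) (I p u)) ->
  forall p u v, w' (phi p) (dmap phi u) (dmap phi v) = w p u v.
Proof.
move=> can /gcs_isomorphic_sym [I1 [/isomorphismP [_ b1 _ ac1 _] J1]].
move=> can' [I2 [/isomorphismP [_ b2 _ ac2 _] J2]] [_ [lb _] aI cI _] JI.
have bI p : bijective (I p) by have [] := lb p.
apply: (@canonical_symplectic_unique _ _ _ _ _ _ _ _ phi
  (fun p x => I2 (phi p) (I p (I1 p x))) can can').
- by move=> p; apply: bij_comp (b2 _) _; apply: bij_comp (bI p) (b1 p).
- by move=> p u; have [-> _] := ac2 (phi p) (I p (I1 p u)); rewrite aI; have [-> _] := ac1 p u.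
- move=> p u v; have [_ ->] := ac2 (phi p) (I p (I1 p u)); rewrite cI.
  by have [_ ->] := ac1 p u.
- by move=> p u; rewrite J1 JI J2.
Qed.

End CanonicalForm.

Theorem theorem12 (R : realType) (M : manifold R) :
  (forall (E : courant M) (J : forall p, E p -> E p),
     is_courant E -> ca_neutral E -> ca_transitive E -> is_gcs J -> gcs_nondegenerate J ->
     exists (G : qlie M) (nabla : forall p, tangent M p -> section G -> G p)
            (w : forall p, tangent M p -> tangent M p -> R)
            (A : forall p, G p -> G p),
       is_canonical nabla w A /\
       gcs_isomorphic J (@J_can R M G nabla w A)) /\
  (forall (E E' : courant M)
          (J : forall p, E p -> E p) (J' : forall p, E' p -> E' p),
     is_courant E -> ca_neutral E -> ca_transitive E -> is_gcs J -> gcs_nondegenerate J ->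
     is_courant E' -> ca_neutral E' -> ca_transitive E' -> is_gcs J' ->
     gcs_nondegenerate J' ->
     forall (G G' : qlie M)
            (nabla : forall p, tangent M p -> section G -> G p)
            (nabla' : forall p, tangent M p -> section G' -> G' p)
            (w w' : forall p, tangent M p -> tangent M p -> R)
            (A : forall p, G p -> G p) (A' : forall p, G' p -> G' p),
       is_canonical nabla w A -> gcs_isomorphic J (@J_can R M G nabla w A) ->
       is_canonical nabla' w' A' ->
       gcs_isomorphic J' (@J_can R M G' nabla' w' A') ->
       (gcs_isomorphic J J' -> forall p u v, w p u v = w' p u v) /\
       (gcs_equivalent J J' -> symplectomorphic w w')).
Proof.
split.
  move=> E J cE _ _ gJ nd; exact: nondegenerate_isomorphic_canonical.
move=> E E' J J' _ _ _ _ _ _ _ _ _ _ G G' nabla nabla' w w' A A' can iso can' iso'.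
split.
  move=> [I [eqI JI]] p u v.
  have := canonical_equivalent_symplectic can iso can' iso' eqI JI u v.
  by rewrite !dmap_id.
move=> [phi [I [eqI JI]]]; exists phi; split; first by case: eqI.
exact: canonical_equivalent_symplectic can iso can' iso' eqI JI.
Qed.
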